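(* Every language recognized by $\mathbf{L}\Diamond$ (the Lambek calculus with brackets) is context-free. That is, for every $\mathbf{L}\Diamond$ grammar $G$, the language $L(G)$ generated by $G$ is context-free.
   Context: Types. Let $\mathrm{Pr}=\{p_1,p_2,p_3,\dots\}$ be an infinite set of primitive types. For a set $\mathcal{B}$, $\mathrm{Tp}(\mathcal{B})$ is the smallest superset of $\mathcal{B}$ such that $A,B\in \mathrm{Tp}(\mathcal{B})$ implies $A\backslash B,\ B/A,\ A\bullet B,\ \Diamond A,\ \Box^{\downarrow}A\in\mathrm{Tp}(\mathcal{B})$. A type is an element of $\mathrm{Tp}(\mathrm{Pr})$. Type trees and type hedges (simultaneous induction): every type is a type tree; if $\Gamma$ is a type hedge then $\langle\Gamma\rangle$ is a type tree; if $T_1,\dots,T_n$ ($n\ge 0$) are type trees then the finite sequence $T_1\dots T_n$ is a type hedge (empty if $n=0$). Juxtaposition $\Pi\;\Gamma$ is concatenation of hedges. The yield of a hedge is the string of types obtained by removing all angle brackets. A context $\Gamma[\blacksquare]$ is like a type hedge except that exactly one leaf is labeled by the special symbol $\blacksquare$ (all other leaf labels being types); $\Gamma[\Delta]$ is the hedge obtained by replacing that leaf by the hedge $\Delta$ (spliced in among the siblings of the leaf). A sequent is $\Gamma\rightarrow A$ with $\Gamma$ a type hedge (the antecedent) and $A$ a type. The calculus $\mathbf{L}\Diamond$. Initial sequents: $p_i\rightarrow p_i$ for primitive types $p_i$. Rules (premises $\Rightarrow$ conclusion): - $(\backslash\rightarrow)$: $\Gamma\rightarrow A$ and $\Delta[B]\rightarrow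 C$ $\Rightarrow$ $\Delta[\Gamma\; A\backslash B]\rightarrow C$. - $(\rightarrow\backslash)$: $A\;\Pi\rightarrow B$ $\Rightarrow$ $\Pi\rightarrow A\backslash B$, where $\Pi$ is nonempty. - $(/\rightarrow)$: $\Gamma\rightarrow A$ and $\Delta[B]\rightarrow C$ $\Rightarrow$ $\Delta[B/A\;\Gamma]\rightarrow C$. - $(\rightarrow/)$: $\Pi\;A\rightarrow B$ $\Rightarrow$ $\Pi\rightarrow B/A$, where $\Pi$ is nonempty. - $(\bullet\rightarrow)$: $\Gamma[A\;B]\rightarrow C$ $\Rightarrow$ $\Gamma[A\bullet B]\rightarrow C$. - $(\rightarrow\bullet)$: $\Gamma\rightarrow A$ and $\Delta\rightarrow B$ $\Rightarrow$ $\Gamma\;\Delta\rightarrow A\bullet B$. - $(\Diamond\rightarrow)$: $\Gamma[\langle A\rangle]\rightarrow B$ $\Rightarrow$ $\Gamma[\Diamond A]\rightarrow B$. - $(\rightarrow\Diamond)$: $\Gamma\rightarrow A$ $\Rightarrow$ $\langle\Gamma\rangle\rightarrow\Diamond A$. - $(\Box^{\downarrow}\rightarrow)$: $\Gamma[A]\rightarrow B$ $\Rightarrow$ $\Gamma[\langle\Box^{\downarrow}A\rangle]\rightarrow B$. - $(\rightarrow\Box^{\downarrow})$: $\langle\Gamma\rangle\rightarrow A$ $\Rightarrow$ $\Gamma\rightarrow\Box^{\downarrow}A$. - Cut: $\Gamma\rightarrow A$ and $\Delta[A]\rightarrow B$ $\Rightarrow$ $\Delta[\Gamma]\rightarrow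 B$. A sequent is provable if it can be derived from initial sequents by these rules. Grammars. An $\mathbf{L}\Diamond$ grammar is a triple $G=(\Sigma,I,D)$ where $\Sigma$ is a finite alphabet, $I$ is a finite subset of $\Sigma\times\mathrm{Tp}(\mathrm{Pr})$, and $D$ is a type. A string $w=a_1\dots a_n$ ($n\ge 0$) is generated by $G$ if there is a sequent $\Gamma\rightarrow D$ provable in $\mathbf{L}\Diamond$ such that the yield of $\Gamma$ is $A_1\dots A_n$ and $(a_i,A_i)\in I$ for each $i=1,\dots,n$. $L(G)$ is the set of strings $w\in\Sigma^*$ generated by $G$. A language is recognized by $\mathbf{L}\Diamond$ if it is $L(G)$ for some $\mathbf{L}\Diamond$ grammar $G$. *)

(* Defs.v *)
From HB Require Import structures.
From Stdlib Require Export Relation_Operators.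
From mathcomp Require Export all_boot.

Set Implicit Arguments.
Unset Strict Implicit.
Unset Printing Implicit Defensive.

(* Arguments of the divisions are in the order in which they are written:
   [ldiv A B] is A \ B and [rdiv B A] is B / A, so that in both cases A is the
   denominator and B the numerator. *)
Inductive tp : Type :=
| prim (i : nat)
| ldiv (A B : tp)
| rdiv (B A : tp)
| prod_tp (A B : tp)
| dia (A : tp)
| box (A : tp).

Lemma tp_comparable : comparable tp.
Proof. by rewrite /comparable /decidable; decide equality; apply: eq_comparable. Qed.

HB.instance Definition _ := hasDecEq.Build tp (compareP tp_comparable).

Inductive tree : Type :=
| leaf (A : tp)
| bracket (G : seq tree).

Definition hedge := seq tree.

Fixpoint tree_yield (t : tree) : seq tp :=
  match t with
  | leaf A => [:: A]
  | bracket G => flatten (map tree_yield G)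
  end.

Definition yield (G : hedge) : seq tp := flatten (map tree_yield G).

(* A hedge with exactly one hole, described by the path from the roots of the
   hedge to the hole: [hole L R] is the hedge L _ R, whose hole is one of the
   roots, and [inside L C R] is the hedge L <C> R, whose hole is that of C. *)
Inductive context : Type :=
| hole (L R : hedge)
| inside (L : hedge) (C : context) (R : hedge).

Fixpoint fill (C : context) (H : hedge) : hedge :=
  match C with
  | hole L R => L ++ H ++ R
  | inside L C R => L ++ [:: bracket (fill C H)] ++ R
  end.

Inductive provable : hedge -> tp -> Prop :=
| ax i : provable [:: leaf (prim i)] (prim i)
| ldiv_l G D A B C :
    provable G A -> provable (fill D [:: leaf B]) C ->
    provable (fill D (G ++ [:: leaf (ldiv A B)])) C
| ldiv_r P A B :
    P <> [::] -> provable ([:: leaf A] ++ P) B -> provable P (ldiv A B)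
| rdiv_l G D A B C :
    provable G A -> provable (fill D [:: leaf B]) C ->
    provable (fill D ([:: leaf (rdiv B A)] ++ G)) C
| rdiv_r P A B :
    P <> [::] -> provable (P ++ [:: leaf A]) B -> provable P (rdiv B A)
| prod_l G A B C :
    provable (fill G [:: leaf A; leaf B]) C ->
    provable (fill G [:: leaf (prod_tp A B)]) C
| prod_r G D A B :
    provable G A -> provable D B -> provable (G ++ D) (prod_tp A B)
| dia_l G A B :
    provable (fill G [:: bracket [:: leaf A]]) B ->
    provable (fill G [:: leaf (dia A)]) B
| dia_r G A :
    provable G A -> provable [:: bracket G] (dia A)
| box_l G A B :
    provable (fill G [:: leaf A]) B ->
    provable (fill G [:: bracket [:: leaf (box A)]]) B
| box_r G A :
    provable [:: bracket G] A -> provable G (box A)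
| cut G D A B :
    provable G A -> provable (fill D [:: leaf A]) B -> provable (fill D G) B.

Definition language (Sigma : finType) : Type := seq Sigma -> Prop.

(* The finite relation I between letters and types is listed by [lexicon]. *)
Record ld_grammar (Sigma : finType) : Type := LDGrammar {
  lexicon : seq (Sigma * tp);
  target : tp
}.

(* [all2] also requires the word and the yield to have the same length. *)
Definition ld_language (Sigma : finType) (G : ld_grammar Sigma) :
    language Sigma :=
  fun w => exists2 Gam : hedge, provable Gam (target G) &
    all2 (fun a A => (a, A) \in lexicon G) w (yield Gam).

Record cfg (Sigma : finType) : Type := CFG {
  nonterminal : finType;
  start : nonterminal;
  rules : seq (nonterminal * seq (nonterminal + Sigma))
}.

Inductive cfg_step (Sigma : finType) (G : cfg Sigma) :
    seq (nonterminal G + Sigma) -> seq (nonterminal G + Sigma) -> Prop :=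
| CFGStep u v X alpha :
    (X, alpha) \in rules G -> cfg_step (u ++ [:: inl X] ++ v) (u ++ alpha ++ v).

Definition cfg_language (Sigma : finType) (G : cfg Sigma) : language Sigma :=
  fun w => clos_refl_trans _ (@cfg_step Sigma G)
    [:: inl (start G)] [seq inr a | a <- w].

Definition context_free (Sigma : finType) (L : language Sigma) : Prop :=
  exists G : cfg Sigma, forall w : seq Sigma, L w <-> cfg_language G w.

(* Main.v *)
Require Import Defs.
From HB Require Import structures.
From Stdlib Require Import Classical.
From mathcomp Require Import zify.

Set Implicit Arguments.
Unset Strict Implicit.
Unset Printing Implicit Defensive.

(** The proof is an adaptation of Pentus's method.  Hedges are written as
    words over types and brackets, so that a context is just a pair of words;
    [der] is a cut-free calculus on these words.  Modalities and opening
    brackets carry indices, like primitive types do; indices serve only to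
    tell occurrences apart.  The calculus of hedges, cut included, is sound in a
    model built from [der], which gives [provable_der]; conversely a derivable
    word is the linearization of a hedge, and its sequent without indices is
    provable ([der_provable]).

    A bracketed segment of a derivable sequent always has an interpolant that
    is read off from a subtype: if the word U <W> V derives C, then either
    some subtype dia F satisfies W -> F and U (dia F) V -> C, or some subtype
    box F satisfies W -> box F and U F V -> C ([bracket_splitP]).  Hence a
    grammar only has to generate derivable sequents without brackets whose
    types are subtypes of the lexicon and of the target.

    Those sequents form a context-free set because each of them is obtained by
    cuts from sequents with at most two antecedent types, all of whose types
    have at most m occurrences of primitive types and modalities, where m
    bounds the subtypes of the grammar ([derives_flat]).  To see this, rename
    indices so that each one occurs at most twice in the sequent
    ([thin_exists]).  Interpret types in the free group on the indices, where a
    derivable sequent becomes an equality ([der_act]).  An interpolant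
    ([interpolation]) of a part of a thin sequent contains each index at most
    once, so that its number of occurrences is the length of its reduced
    value.  In a product of reduced words that is trivial, some two adjacent
    factors have a product no longer than the longer of the two
    ([gprod_nil_split]); replacing the corresponding two types (or all types
    but the last, when the two factors are the last type and the inverse of the
    succedent) by an interpolant keeps the bound m and shortens the sequent
    ([thin_binary]).

    There are finitely many types within the bound, and they are the
    nonterminals.  The rules are all the rules of length at most two that are
    sound for the languages of the types; soundness of the grammar is then
    immediate, and completeness only needs the soundness of the rules that the
    decomposition above uses. *)

(** * Words with brackets and a cut-free calculus *)

(** Types whose modalities are indexed, as primitive types are.  Distinct indices
    keep the occurrences of a modality apart in a thin sequent; [emb] below gives
    all modalities the index 0. *)
Inductive itp : Type :=
| Prim (i : nat)
| Ldiv (A B : itp)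
| Rdiv (B A : itp)
| Prod (A B : itp)
| Dia (i : nat) (A : itp)
| Box (i : nat) (A : itp).

Lemma itp_comparable : comparable itp.
Proof. by rewrite /comparable /decidable; decide equality; apply: eq_comparable. Qed.

HB.instance Definition _ := hasDecEq.Build itp (compareP itp_comparable).

(** A closing bracket needs no index: the free group interpretation maps it to 1. *)
Inductive sym : Type := Op (i : nat) | Cl | Ty (A : itp).

Definition word := seq sym.

(** Bracket depth at the end of [W] when [n] brackets are open at the start; [None]
    when a bracket is closed that was never opened. *)
Fixpoint run (n : nat) (W : word) : option nat :=
  match W with
  | [::] => Some n
  | Op _ :: W' => run n.+1 W'
  | Cl :: W' => if n is n'.+1 then run n' W' else None
  | Ty _ :: W' => run n W'
  end.

Definition bal (W : word) : Prop := run 0 W = Some 0.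

Lemma run_cat n U V : run n (U ++ V) = obind (run^~ V) (run n U).
Proof. by elim: U n => [|[i||A] U IH] [|n] //=. Qed.

Lemma run_add k n m W : run n W = Some m -> run (k + n) W = Some (k + m).
Proof.
elim: W n => [|[i||A] W IH] n /=; first by case=> ->.
- by rewrite -addnS; apply: IH.
- by case: n => // n; rewrite addnS; apply: IH.
- exact: IH.
Qed.

Lemma run_bal_cat k W m : bal W -> run k (W ++ m) = run k m.
Proof. by move=> /(run_add k); rewrite addn0 run_cat => ->. Qed.

Lemma run_cat_some n U V m :
  run n (U ++ V) = Some m -> exists2 k, run n U = Some k & run k V = Some m.
Proof. by rewrite run_cat; case: (run n U) => // k; exists k. Qed.

Lemma bal_Ty A W : bal W -> bal (Ty A :: W).
Proof. by []. Qed.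

Lemma bal_nil : bal [::].
Proof. by []. Qed.

Lemma bal_cat U V : bal U -> bal V -> bal (U ++ V).
Proof. by move=> bU bV; rewrite /bal run_bal_cat. Qed.

Lemma bal_catl U V : bal U -> bal (U ++ V) -> bal V.
Proof. by move=> bU; rewrite /bal run_bal_cat. Qed.

Lemma bal_catr U V : bal V -> bal (U ++ V) -> bal U.
Proof.
rewrite /bal => bV /run_cat_some[k -> /=].
by have := run_add k bV; rewrite addn0 => ->.
Qed.

(** A prefix of [Y ++ Z] never closes too much and a suffix of [X ++ Y] leaves
    nothing open.  This is what lets interpolation respect brackets: where a
    segment partly overlaps the antecedent of a premise, the overlap is a legitimate
    segment of that premise. *)
Lemma bal_overlap X Y Z : bal (X ++ Y) -> bal (Y ++ Z) -> bal Y.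
Proof.
move=> /run_cat_some[x _ hx] /run_cat_some[y hy _].
by have := run_add x hy; rewrite addn0 hx /bal hy => -[/esym/eqP]; rewrite addn_eq0 => /andP[_ /eqP->].
Qed.

Lemma bal_subst U K K' V : bal K -> bal K' -> bal (U ++ K ++ V) -> bal (U ++ K' ++ V).
Proof.
rewrite /bal => bK bK' /run_cat_some[k hk]; rewrite run_bal_cat // => h.
by rewrite run_cat hk /= run_bal_cat.
Qed.

Lemma bal_br i W : bal W -> bal (Op i :: W ++ [:: Cl]).
Proof. by move=> bW; rewrite /bal /= run_bal_cat. Qed.

(** [X] closes only brackets that it opens, so the one before it stays open. *)
Lemma not_bal_Op i X Y : bal (X ++ Y) -> ~ bal (Op i :: X).
Proof.
rewrite /bal /= => /run_cat_some[k hk _] h.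
by have := run_add 1 hk; rewrite h.
Qed.

Lemma bal_cons_Cl_inj X Y U V :
  bal X -> bal Y -> X ++ Cl :: U = Y ++ Cl :: V -> X = Y /\ U = V.
Proof.
rewrite /bal; move: {1 3}0 => n.
elim: X Y n => [|x X IH] [|y Y] n /=.
- by move=> _ _ [].
- by move=> [->] hY [e _]; rewrite -e in hY.
- by move=> hX [e0] [e _]; rewrite e e0 in hX.
- move=> hX hY [e1 e2]; subst y.
  case: x hX hY => [i||A] /=; last by move=> a b; have [-> ->] := IH _ _ a b e2.
    by move=> a b; have [-> ->] := IH _ _ a b e2.
  by case: n => // n a b; have [-> ->] := IH _ _ a b e2.
Qed.

(** All rules but one keep the antecedent balanced; the right rule for [Box] has to
    require it: the word of <A><B> -> C also has the form of <W> -> C with W the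
    unbalanced word A><B. *)
Inductive der : word -> itp -> Prop :=
| d_ax p : der [:: Ty (Prim p)] (Prim p)
| d_ldl G U V A B C :
    der G A -> der (U ++ Ty B :: V) C -> der (U ++ G ++ Ty (Ldiv A B) :: V) C
| d_ldr W A B : W <> [::] -> der (Ty A :: W) B -> der W (Ldiv A B)
| d_rdl G U V A B C :
    der G A -> der (U ++ Ty B :: V) C -> der (U ++ Ty (Rdiv B A) :: G ++ V) C
| d_rdr W A B : W <> [::] -> der (W ++ [:: Ty A]) B -> der W (Rdiv B A)
| d_prl U V A B C :
    der (U ++ Ty A :: Ty B :: V) C -> der (U ++ Ty (Prod A B) :: V) C
| d_prr G D A B : der G A -> der D B -> der (G ++ D) (Prod A B)
| d_dil U V i A C :
    der (U ++ Op i :: Ty A :: Cl :: V) C -> der (U ++ Ty (Dia i A) :: V) C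
| d_dir G i A : der G A -> der (Op i :: G ++ [:: Cl]) (Dia i A)
| d_bol U V i A C :
    der (U ++ Ty A :: V) C -> der (U ++ Op i :: Ty (Box i A) :: Cl :: V) C
| d_bor W i A :
    W <> [::] -> bal W -> der (Op i :: W ++ [:: Cl]) A -> der W (Box i A).

Lemma cat_neq_nil T (s1 s2 : seq T) x : s1 ++ x :: s2 <> [::].
Proof. by case: s1. Qed.
#[local] Hint Extern 0 (_ <> _) => apply: cat_neq_nil : core.

Ltac cat_norm := by rewrite ?cats0 /= -?catA /= -?catA ?cats0.

Lemma der_cast W W' A : der W A -> W = W' -> der W' A.
Proof. by move=> d <-. Qed.

Lemma der_bal W A : der W A -> bal W.
Proof.
elim=> {W A} //.
- move=> G U V A B C _ bG _ bU.
  have := @bal_subst U [:: Ty B] (G ++ [:: Ty (Ldiv A B)]) V (bal_Ty _ bal_nil) (bal_cat bG (bal_Ty _ bal_nil)) bU.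
  by rewrite -catA.
- move=> G U V A B C _ bG _ bU.
  exact: (@bal_subst U [:: Ty B] (Ty (Rdiv B A) :: G) V (bal_Ty _ bal_nil) _ bU).
- by move=> W A B _ _; apply: (@bal_catr _ [:: Ty A]).
- move=> U V A B C _ bU.
  exact: (@bal_subst U [:: Ty A; Ty B] [:: Ty _] V (bal_Ty _ bal_nil) _ bU).
- by move=> *; apply: bal_cat.
- move=> U V i A C _ bU.
  exact: (@bal_subst U [:: Op i; Ty A; Cl] [:: Ty _] V (bal_Ty _ bal_nil) _ bU).
- by move=> *; apply: bal_br.
- move=> U V i A C _ bU.
  exact: (@bal_subst U [:: Ty A] [:: Op i; Ty _; Cl] V (bal_Ty _ bal_nil) _ bU).
Qed.

Lemma der_nonempty W A : der W A -> W <> [::].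
Proof.
elim=> {W A} //; try by move=> *; apply: cat_neq_nil.
- by move=> *; rewrite catA; apply: cat_neq_nil.
- by case.
Qed.

Lemma der_id A : der [:: Ty A] A.
Proof.
elim: A => [i|A dA B dB|B dB A dA|A dA B dB|i A dA|i A dA].
- exact: d_ax.
- by apply: d_ldr => //; apply: (@d_ldl [:: _] [::] [::]).
- by apply: d_rdr => //; apply: (@d_rdl [:: _] [::] [::]).
- by apply: (@d_prl [::] [::]); apply: (@d_prr [:: _] [:: _]).
- by apply: (@d_dil [::] [::]); apply: (@d_dir [:: _]).
- by apply: d_bor => //; apply: (@d_bol [::] [::]).
Qed.

(** * Relative positions of segments *)

Lemma cat_split T (a b c d : seq T) : a ++ b = c ++ d ->
  (exists e, c = a ++ e /\ b = e ++ d) \/ (exists x e, a = c ++ x :: e /\ d = x :: e ++ b).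
Proof.
elim: a c => [|y a IH] [|z c] /=.
- by move=> ->; left; exists [::].
- by move=> ->; left; exists (z :: c).
- by move=> <-; right; exists y, a.
- by move=> [-> /IH [[e [-> ->]]|[x [e [-> ->]]]]]; [left; exists e|right; exists x, e].
Qed.

Lemma cat_split_cons T (a b c d : seq T) y : a ++ b = c ++ y :: d ->
  (exists e, a = c ++ y :: e /\ d = e ++ b) \/ (exists e, c = a ++ e /\ b = e ++ y :: d).
Proof.
move=> /cat_split [[e [-> ->]]|[x [e [-> [<- ->]]]]]; first by right; exists e.
by left; exists e.
Qed.

Lemma factor_cons T (U K V U0 V0 : seq T) x : U ++ K ++ V = U0 ++ x :: V0 ->
  [\/ exists U', U = U0 ++ x :: U' /\ V0 = U' ++ K ++ V,
      exists K1 K2, [/\ K = K1 ++ x :: K2, U0 = U ++ K1 & V0 = K2 ++ V]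
    | exists V', U0 = U ++ K ++ V' /\ V = V' ++ x :: V0].
Proof.
move=> e; case: (cat_split_cons e) => [[U' [-> ->]]|[K1 [-> {}e]]]; last case: (cat_split_cons e) => [[K2 [-> ->]]|[V' [-> ->]]].
- by apply: Or31; exists U'.
- by apply: Or32; exists K1, K2.
- by apply: Or33; exists V'.
Qed.

Lemma factor_cat (U K V G D : word) : bal K -> bal G -> U ++ K ++ V = G ++ D ->
  [\/ exists U', U = G ++ U' /\ D = U' ++ K ++ V,
      exists V', G = U ++ K ++ V' /\ V = V' ++ D
    | exists K1 K2, [/\ K = K1 ++ K2, K1 <> [::], K2 <> [::], bal K1 & bal K2
                    /\ (G = U ++ K1 /\ D = K2 ++ V)]].
Proof.
move=> bK bG h; case: (cat_split h) => [[e [eG {}h]]|[x [U' [-> ->]]]]; last first.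
  by apply: Or31; exists (x :: U').
case: (cat_split h) => [[V' [eV ->]]|[x [K2 [eK ->]]]].
  by apply: Or32; exists V'; rewrite eG eV.
case: e => [|y K1] in eG eK {h} *.
  by apply: Or31; exists [::]; rewrite eG !cats0 eK.
apply: Or33; exists (y :: K1), (x :: K2).
have b1 : bal (y :: K1) by apply: (@bal_overlap U _ (x :: K2)); rewrite -?eG -?eK.
by split=> //; split=> //; apply: (bal_catl b1); rewrite -eK.
Qed.

(** The possible positions of a segment [K] relative to the active part
    [G ++ [:: Ty X]] of the left rule for [Ldiv].  In the last two cases [K] cuts
    through [G]; the pieces are balanced by [bal_overlap]. *)
Inductive arg_left U K V U0 G V0 X : Prop :=
| AL_left V' of U0 = U ++ K ++ V' & V = V' ++ G ++ Ty X :: V0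
| AL_right U' of U = U0 ++ G ++ Ty X :: U' & V0 = U' ++ K ++ V
| AL_arg G1 G2 of G = G1 ++ K ++ G2 & U = U0 ++ G1 & V = G2 ++ Ty X :: V0
| AL_whole K1 K2 of K = K1 ++ G ++ Ty X :: K2 & U0 = U ++ K1 & V0 = K2 ++ V
| AL_begin K1 G1 G2 of K = K1 ++ G1 & U0 = U ++ K1 & G = G1 ++ G2 & V = G2 ++ Ty X :: V0
   & K1 <> [::] & G1 <> [::] & bal K1 & bal G1
| AL_end G1 G2 K2 of K = G2 ++ Ty X :: K2 & G = G1 ++ G2 & U = U0 ++ G1 & V0 = K2 ++ V
   & G1 <> [::] & bal G1 & bal G2 & bal K2.

Lemma arg_leftP (U K V U0 G V0 : word) X : bal K -> bal G ->
  U ++ K ++ V = U0 ++ G ++ Ty X :: V0 -> arg_left U K V U0 G V0 X.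
Proof.
move=> bK bG h; case: (cat_split h) => [[e [-> {}h]]|[y [U' [-> {}h]]]].
- case: (cat_split h) => [[V' [-> ->]]|[x [K' [eK {}h]]]].
    exact: (@AL_left _ _ _ _ _ _ _ V').
  case: (@cat_split_cons _ (x :: K') _ _ _ _ (esym h)) => [[K2 [eG ->]]|[G2 [eG ->]]].
    by rewrite eG in eK; apply: (@AL_whole _ _ _ _ _ _ _ e K2).
  case: e => [|z e] in eK {h} *.
    by apply: (@AL_arg _ _ _ _ _ _ _ [::] G2); rewrite ?cats0 ?eK.
  have b1 : bal (x :: K') by apply: (@bal_overlap (z :: e) _ G2); rewrite -?eG -?eK.
  have b0 : bal (z :: e) by apply: bal_catr b1 _; rewrite -eK.
  exact: (@AL_begin _ _ _ _ _ _ _ (z :: e) (x :: K') G2).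
- case: (@cat_split_cons _ (y :: U') _ _ _ _ (esym h)) => [[U'' [-> ->]]|[e [eG {}h]]].
    by apply: (@AL_right _ _ _ _ _ _ _ U'') => //; cat_norm.
  case: (cat_split_cons h) => [[K2 [eK ->]]|[G2 [eK ->]]].
  + have b2 : bal e by apply: (@bal_overlap (y :: U') _ (Ty X :: K2)); rewrite -?eG -?eK.
    have b1 : bal (y :: U') by apply: bal_catr b2 _; rewrite -eG.
    have b3 : bal K2 by apply: (bal_catl b2 (V := Ty X :: K2)); rewrite -eK.
    exact: (@AL_end _ _ _ _ _ _ _ (y :: U') e K2).
  + by apply: (@AL_arg _ _ _ _ _ _ _ (y :: U') G2); rewrite ?eG ?eK.
Qed.

(** The mirror image of [arg_left], for the left rule for [Rdiv]. *)
Inductive arg_right (U K V U0 : word) X (G V0 : word) : Prop :=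
| AR_left V' of U0 = U ++ K ++ V' & V = V' ++ Ty X :: G ++ V0
| AR_right U' of U = U0 ++ Ty X :: G ++ U' & V0 = U' ++ K ++ V
| AR_arg G1 G2 of G = G1 ++ K ++ G2 & U = U0 ++ Ty X :: G1 & V = G2 ++ V0
| AR_whole K1 K2 of K = K1 ++ Ty X :: G ++ K2 & U0 = U ++ K1 & V0 = K2 ++ V
| AR_end G1 G2 K2 of K = G2 ++ K2 & G = G1 ++ G2 & U = U0 ++ Ty X :: G1 & V0 = K2 ++ V
   & G2 <> [::] & K2 <> [::] & bal G2 & bal K2
| AR_begin K1 G1 G2 of K = K1 ++ Ty X :: G1 & U0 = U ++ K1 & G = G1 ++ G2 & V = G2 ++ V0
   & G2 <> [::] & bal K1 & bal G1 & bal G2.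

Lemma arg_rightP (U K V U0 G V0 : word) X : bal K -> bal G ->
  U ++ K ++ V = U0 ++ Ty X :: G ++ V0 -> arg_right U K V U0 X G V0.
Proof.
move=> bK bG h; case: (factor_cons h) => [[U' [-> /esym {}h]]|[K1 [K2' [eK -> {}h]]]|[V' [-> ->]]].
- case: (factor_cat bK bG h) => [[U'' [-> ->]]|[V' [eG ->]]|[G2 [K2 [eK n1 n2 b1 [b2 [eG ->]]]]]].
  + by apply: (@AR_right _ _ _ _ _ _ _ U'').
  + exact: (@AR_arg _ _ _ _ _ _ _ U' V').
  + exact: (@AR_end _ _ _ _ _ _ _ U' G2 K2).
- case: (cat_split h) => [[e [eK2 ->]]|[x [e [eG ->]]]].
    by apply: (@AR_whole _ _ _ _ _ _ _ K1 e); rewrite // eK eK2.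
  have b1 : bal K2' by apply: (@bal_overlap (K1 ++ [:: Ty X]) _ (x :: e)); rewrite -?eG // -catA -eK.
  have b2 : bal K1 by apply: (@bal_catr _ (Ty X :: K2')) => //; rewrite -eK.
  have b3 : bal (x :: e) by apply: bal_catl b1 _; rewrite -eG.
  exact: (@AR_begin _ _ _ _ _ _ _ K1 K2' (x :: e)).
- exact: (@AR_left _ _ _ _ _ _ _ V').
Qed.

(** The outer brackets match each other, so a balanced segment contains both of them
    or none. *)
Lemma factor_bracket (U K V G : word) i : bal K -> K <> [::] -> bal G ->
  U ++ K ++ V = Op i :: G ++ [:: Cl] ->
  [/\ K = Op i :: G ++ [:: Cl], U = [::] & V = [::]]
  \/ exists U' V', [/\ G = U' ++ K ++ V', U = Op i :: U' & V = V' ++ [:: Cl]].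
Proof.
move=> bK nK bG; case: U => [|x U] /=.
  case: K nK bK => // x K _ bK [ex h]; subst x.
  case: (cat_split h) => [[e [eG eV]]|[x [e [-> [<- e0]]]]].
    by case: (@not_bal_Op i K e); rewrite -?eG.
  by left; case: e e0 => // e0; case: V e0 {h}.
case=> -> h; right; case: (factor_cat bK bG h) => [[U' [_ e]]|[V' [-> ->]]|[K1 [K2 [eK _ n2 _ [b2 [_ e]]]]]].
- case: K nK bK e {h} => // y K _ bK.
  by case: U' => [|z [|? ?]] //= [e]; rewrite -e in bK.
- by exists U, V'.
- by case: K2 n2 b2 e {eK} => // y K2 _ + [e]; rewrite -e.
Qed.

(** In the second case the segment is the principal type alone, without its
    brackets. *)
Lemma factor_box (U K V U0 V0 : word) i X : bal K -> K <> [::] ->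
  U ++ K ++ V = U0 ++ Op i :: Ty X :: Cl :: V0 ->
  [\/ exists U', U = U0 ++ Op i :: Ty X :: Cl :: U' /\ V0 = U' ++ K ++ V,
      [/\ K = [:: Ty X], U = U0 ++ [:: Op i] & V = Cl :: V0],
      exists K1 K2, [/\ K = K1 ++ Op i :: Ty X :: Cl :: K2, U0 = U ++ K1 & V0 = K2 ++ V]
    | exists V', U0 = U ++ K ++ V' /\ V = V' ++ Op i :: Ty X :: Cl :: V0].
Proof.
move=> bK nK h; case: (factor_cons h) => [[U' [-> {}h]]|[K1 [K2 [eK -> {}h]]]|[V' [-> ->]]].
- case: U' h => [|y [|z U']] /=.
  + case: K nK bK => // y [|z K] _ bK [ey] /=; first by move=> <-; rewrite -ey; apply: Or42.
    by move=> e _; rewrite -ey -e /bal /= in bK.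
  + by case: K nK bK => // y' K _ bK [_ e _]; rewrite -e in bK.
  + by case=> <- <- ->; apply: Or41; exists U'.
- case: K2 h eK => [|y [|z K2]] /=.
  + by move=> _ eK; move: bK; rewrite eK /bal run_cat; case: (run 0 K1).
  + by case=> <- _ eK; move: bK; rewrite eK /bal run_cat; case: (run 0 K1).
  + by case=> <- <- -> ->; apply: Or43; exists K1, K2.
- by apply: Or44; exists V'.
Qed.

(** * Interpolation *)

Fixpoint gens (A : itp) : seq nat :=
  match A with
  | Prim i => [:: i]
  | Ldiv A B | Rdiv B A => gens A ++ gens B
  | Prod A B => gens A ++ gens B
  | Dia i A | Box i A => i :: gens A
  end.

Definition sym_gens (s : sym) : seq nat :=
  match s with Op i => [:: i] | Cl => [::] | Ty A => gens A end.

Definition word_gens (W : word) : seq nat := flatten (map sym_gens W).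

Notation occ n A := (count_mem n (gens A)).
Notation woccs n W := (count_mem n (word_gens W)).

Lemma word_gens_cat U V : word_gens (U ++ V) = word_gens U ++ word_gens V.
Proof. by rewrite /word_gens map_cat flatten_cat. Qed.

Lemma word_gens_cons s V : word_gens (s :: V) = sym_gens s ++ word_gens V.
Proof. by []. Qed.

Lemma word_gens_nil : word_gens [::] = [::].
Proof. by []. Qed.

Lemma sym_gensE :
  ((forall i, sym_gens (Op i) = [:: i]) * (sym_gens Cl = [::])
  * (forall A, sym_gens (Ty A) = gens A)
  * (forall i, gens (Prim i) = [:: i])
  * (forall A B, gens (Ldiv A B) = gens A ++ gens B)
  * (forall A B, gens (Rdiv B A) = gens A ++ gens B)
  * (forall A B, gens (Prod A B) = gens A ++ gens B)
  * (forall i A, gens (Dia i A) = i :: gens A)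
  * (forall i A, gens (Box i A) = i :: gens A))%type.
Proof. by []. Qed.

Lemma count_memE :
  (forall n : nat, count_mem n [::] = 0)
  * (forall (n i : nat) s, count_mem n (i :: s) = (i == n) + count_mem n s).
Proof. by []. Qed.

Definition gensE :=
  (word_gens_cat, word_gens_cons, word_gens_nil, sym_gensE, count_cat, count_memE).

Ltac der_by d := apply: (der_cast d); cat_norm.
Ltac occ_lia :=
  let n := fresh "n" in
  intro n; repeat match goal with h : forall _ : _, is_true _ |- _ => move: (h n); clear h end;
  rewrite ?gensE; lia.

Definition interpolant K (U V : word) C E :=
  [/\ der K E, der (U ++ Ty E :: V) C, forall n : nat, occ n E <= woccs n K
    & forall n : nat, occ n E <= woccs n U + woccs n V + occ n C].

(** By induction on the derivation.  A segment that lies in one premise keeps the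
    interpolant it has there.  When it meets both premises, the interpolants of its
    two parts are combined: by a product if the principal type lies outside the segment, by a division if it
    lies inside.  Each index of the interpolant is charged
    to an occurrence in the segment and to one outside it. *)
Lemma interpolation U K V C : bal K -> K <> [::] -> der (U ++ K ++ V) C ->
  exists E, interpolant K U V C E.
Proof.
move: {2}(U ++ K ++ V) (erefl (U ++ K ++ V)) => W eW bK nK d.
rewrite eW in d.
elim: d U K V bK nK eW => {W C}
 [p|G U0 V0 A B C dG IG dC IC|W A B nW dB IB|G U0 V0 A B C dG IG dC IC|W A B nW dB IB
 |U0 V0 A B C dC IC|G D A B dG IG dD ID|U0 V0 i A C dC IC|G i A dA IA|U0 V0 i A C dC IC|W i A nW bW dA IA] U K V bK nK eW.
- case: U eW => [|x [|? ?]] //=; last by case: K nK {bK}.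
  case: K bK nK => [|x [|y K]] //= _ _ [-> eV]; case: V eV => // _.
  by exists (Prim p); split; [apply: d_ax|apply: d_ax|occ_lia|occ_lia].
- case: (arg_leftP bK (der_bal dG) eW) => 
   [V' eU0 eV|U' eU eV0|G1 G2 eG eU eV|K1 K2 eK eU0 eV0|K1 G1 G2 eK eU0 eG eV n1 n2 b1 b2|G1 G2 K2 eK eG eU eV0 n1 b1 b2 b3]; subst.
  + case: (IC U K (V' ++ Ty B :: V0)) => // [|E [d1 d2 c1 c2]]; first by cat_norm.
    exists E; split=> //; last occ_lia.
    have d := @d_ldl G (U ++ Ty E :: V') V0 A B C dG; rewrite -!catA /= in d.
    by apply: d.
  + case: (IC (U0 ++ Ty B :: U') K V) => // [|E [d1 d2 c1 c2]]; first by cat_norm.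
    exists E; split=> //; last occ_lia.
    rewrite -catA /= in d2; der_by (d_ldl dG d2).
  + case: (IG G1 K G2) => // E [d1 d2 c1 c2].
    exists E; split=> //; last occ_lia.
    der_by (d_ldl d2 dC).
  + have bK' : bal (K1 ++ Ty B :: K2).
      apply: (@bal_subst K1 (G ++ [:: Ty (Ldiv A B)]) [:: Ty B] K2) => //.
        exact: bal_cat (der_bal dG) _.
      by rewrite -catA.
    case: (IC U (K1 ++ Ty B :: K2) V) => // [|E [d1 d2 c1 c2]]; first by cat_norm.
    exists E; split=> //; [der_by (d_ldl dG d1)|occ_lia].
  + case: (IG [::] G1 G2) => // E1 [d1 d2 c1 c2].
    case: (IC U K1 (Ty B :: V0)) => // [|E2 [d3 d4 c3 c4]]; first by cat_norm.
    (* [K1] ends before the principal type, in the middle of its argument. *)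
    exists (Prod E2 E1); split; [exact: d_prr| |occ_lia|occ_lia].
    apply: d_prl.
    have d := @d_ldl (Ty E1 :: G2) (U ++ [:: Ty E2]) V0 A B C d2; rewrite -!catA in d.
    exact: d.
  + case: (IG [::] G1 G2) => // E1 [d1 d2 c1 c2].
    case: (IC U0 (Ty B :: K2) V) => // E2 [d3 d4 c3 c4].
    (* [E1] interpolates the part of the argument that stays outside the segment, so
       the segment still expects [E1] on its left. *)
    exists (Ldiv E1 E2); split; [|der_by (d_ldl d1 d4)|occ_lia|occ_lia].
    apply: d_ldr; first exact: cat_neq_nil.
    exact: (@d_ldl (Ty E1 :: G2) [::] K2).
- case: (IB (Ty A :: U) K V) => // [|E [d1 d2 c1 c2]]; first by rewrite -eW.
  exists E; split=> //; last occ_lia.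
  exact: d_ldr.
- case: (arg_rightP bK (der_bal dG) eW) =>
   [V' eU0 eV|U' eU eV0|G1 G2 eG eU eV|K1 K2 eK eU0 eV0|G1 G2 K2 eK eG eU eV0 n1 n2 b1 b2|K1 G1 G2 eK eU0 eG eV n1 b1 b2 b3]; subst.
  + case: (IC U K (V' ++ Ty B :: V0)) => // [|E [d1 d2 c1 c2]]; first by cat_norm.
    exists E; split=> //; last occ_lia.
    have d := @d_rdl G (U ++ Ty E :: V') V0 A B C dG; rewrite -!catA /= in d.
    by apply: d.
  + case: (IC (U0 ++ Ty B :: U') K V) => // [|E [d1 d2 c1 c2]]; first by cat_norm.
    exists E; split=> //; last occ_lia.
    rewrite -catA /= in d2; der_by (d_rdl dG d2).
  + case: (IG G1 K G2) => // E [d1 d2 c1 c2].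
    exists E; split=> //; last occ_lia.
    der_by (d_rdl d2 dC).
  + have bK' : bal (K1 ++ Ty B :: K2).
      apply: (@bal_subst K1 (Ty (Rdiv B A) :: G) [:: Ty B] K2) => //.
      exact: der_bal dG.
    case: (IC U (K1 ++ Ty B :: K2) V) => // [|E [d1 d2 c1 c2]]; first by cat_norm.
    exists E; split=> //; [der_by (d_rdl dG d1)|occ_lia].
  + case: (IG G1 G2 [::]) => // [|E1 [d1 d2 c1 c2]]; first by rewrite cats0.
    case: (IC (U0 ++ [:: Ty B]) K2 V) => // [|E2 [d3 d4 c3 c4]]; first by cat_norm.
    exists (Prod E1 E2); split; [exact: d_prr| |occ_lia|occ_lia].
    apply: d_prl; rewrite -catA in d4.
    der_by (d_rdl d2 d4).
  + case: (IG G1 G2 [::]) => // [|E1 [d1 d2 c1 c2]]; first by rewrite cats0.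
    case: (IC U (K1 ++ [:: Ty B]) V0) => // [||E2 [d3 d4 c3 c4]]; [exact: bal_cat|by cat_norm|].
    exists (Rdiv E2 E1); split; [|der_by (d_rdl d1 d4)|occ_lia|occ_lia].
    apply: d_rdr; first exact: cat_neq_nil.
    der_by (d_rdl d2 d3).
- case: (IB U K (V ++ [:: Ty A])) => // [|E [d1 d2 c1 c2]]; first by rewrite -eW; cat_norm.
  exists E; split=> //; last occ_lia.
  by apply: d_rdr => //; der_by d2.
- case: (factor_cons eW) => [[U' [-> eV0]]|[K1 [K2 [eK eU0 eV0]]]|[V' [eU0 ->]]]; subst.
  + case: (IC (U0 ++ Ty A :: Ty B :: U') K V) => // [|E [d1 d2 c1 c2]]; first by cat_norm.
    exists E; split=> //; last occ_lia.
    rewrite -catA /= in d2; der_by (d_prl d2).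
  + case: (IC U (K1 ++ Ty A :: Ty B :: K2) V) => // [||E [d1 d2 c1 c2]]; first 1 last.
    * by cat_norm.
    * by exists E; split=> //; [apply: d_prl|occ_lia].
    * exact: (@bal_subst K1 [:: Ty (Prod A B)] [:: Ty A; Ty B] K2).
  + case: (IC U K (V' ++ Ty A :: Ty B :: V0)) => // [|E [d1 d2 c1 c2]]; first by cat_norm.
    exists E; split=> //; last occ_lia.
    have d := @d_prl (U ++ Ty E :: V') V0 A B C; rewrite -!catA in d.
    exact: d.
- case: (factor_cat bK (der_bal dG) eW) => [[U' [-> eD]]|[V' [eG ->]]|[K1 [K2 [eK n1 n2 b1 [b2 [eG eD]]]]]]; subst.
  + case: (ID U' K V) => // E [d1 d2 c1 c2]; exists E; split=> //; last occ_lia.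
    der_by (d_prr dG d2).
  + case: (IG U K V') => // E [d1 d2 c1 c2]; exists E; split=> //; last occ_lia.
    der_by (d_prr d2 dD).
  + case: (IG U K1 [::]) => // [|E1 [d1 d2 c1 c2]]; first by rewrite cats0.
    case: (ID [::] K2 V) => // E2 [d3 d4 c3 c4].
    exists (Prod E1 E2); split; [exact: d_prr| |occ_lia|occ_lia].
    apply: d_prl; der_by (d_prr d2 d4).
- case: (factor_cons eW) => [[U' [-> eV0]]|[K1 [K2 [eK eU0 eV0]]]|[V' [eU0 ->]]]; subst.
  + case: (IC (U0 ++ Op i :: Ty A :: Cl :: U') K V) => // [|E [d1 d2 c1 c2]]; first by cat_norm.
    exists E; split=> //; last occ_lia.
    rewrite -catA /= in d2; der_by (d_dil d2).
  + case: (IC U (K1 ++ Op i :: Ty A :: Cl :: K2) V) => // [||E [d1 d2 c1 c2]]; first 1 last.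
    * by cat_norm.
    * by exists E; split=> //; [apply: d_dil|occ_lia].
    * exact: (@bal_subst K1 [:: Ty (Dia i A)] [:: Op i; Ty A; Cl] K2).
  + case: (IC U K (V' ++ Op i :: Ty A :: Cl :: V0)) => // [|E [d1 d2 c1 c2]]; first by cat_norm.
    exists E; split=> //; last occ_lia.
    have d := @d_dil (U ++ Ty E :: V') V0 i A C; rewrite -!catA in d.
    exact: d.
- case: (factor_bracket bK nK (der_bal dA) eW) => [[eK eU eV]|[U' [V' [eG eU eV]]]]; subst.
  + case: (IA [::] G [::]) => [|||E [d1 d2 c1 c2]]; [exact: der_bal dA|exact: der_nonempty dA|exact: cats0|].
    exists (Dia i E); split; [exact: d_dir| |occ_lia|occ_lia].
    by apply: (@d_dil [::] [::]); apply: (@d_dir [:: _]).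
  + case: (IA U' K V') => // E [d1 d2 c1 c2]; exists E; split=> //; last occ_lia.
    der_by (d_dir i d2).
- case: (factor_box bK nK eW) => [[U' [-> eV0]]|[eK eU eV]|[K1 [K2 [eK eU0 eV0]]]|[V' [eU0 ->]]]; subst.
  + case: (IC (U0 ++ Ty A :: U') K V) => // [|E [d1 d2 c1 c2]]; first by cat_norm.
    exists E; split=> //; last occ_lia.
    rewrite -catA /= in d2; der_by (d_bol i d2).
  + case: (IC U0 [:: Ty A] V0) => // E [d1 d2 c1 c2].
    (* The type without its brackets: the interpolant of [A] in the premise must be
       boxed to fit between them. *)
    exists (Box i E); split; [|der_by (d_bol i d2)|occ_lia|occ_lia].
    by apply: d_bor => //; apply: (@d_bol [::] [::]).
  + case: (IC U (K1 ++ Ty A :: K2) V) => // [||E [d1 d2 c1 c2]]; first 1 last.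
    * by cat_norm.
    * by exists E; split=> //; [apply: d_bol|occ_lia].
    * exact: (@bal_subst K1 [:: Op i; Ty (Box i A); Cl] [:: Ty A] K2).
  + case: (IC U K (V' ++ Ty A :: V0)) => // [|E [d1 d2 c1 c2]]; first by cat_norm.
    exists E; split=> //; last occ_lia.
    have d := @d_bol (U ++ Ty E :: V') V0 i A C; rewrite -!catA in d.
    exact: d.
- case: (IA (Op i :: U) K (V ++ [:: Cl])) => // [|E [d1 d2 c1 c2]]; first by rewrite -eW; cat_norm.
  exists E; split=> //; last occ_lia.
  apply: d_bor; [exact: cat_neq_nil| |der_by d2].
  by rewrite -eW in bW; exact: (@bal_subst U K [:: Ty E] V bK (bal_Ty E bal_nil) bW).
Qed.

(** * Interpolants of bracketed segments *)

Definition subtype_closed (P : pred itp) : Prop := forall A, P A ->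
  match A with
  | Prim _ => True
  | Ldiv A B | Rdiv B A => P A /\ P B
  | Prod A B => P A /\ P B
  | Dia _ A | Box _ A => P A
  end.

Definition ty_in (P : pred itp) (s : sym) : bool := if s is Ty A then P A else true.

Definition bracket_split (P : pred itp) i U W V C : Prop := exists F,
  [/\ P (Dia i F), der W F & der (U ++ Ty (Dia i F) :: V) C] \/
  [/\ P (Box i F), der W (Box i F) & der (U ++ Ty F :: V) C].

Lemma bracket_split_inner P i U W W' V C :
  (forall F, der W F -> der W' F) ->
  bracket_split P i U W V C -> bracket_split P i U W' V C.
Proof. by move=> h [F [[p d1 d2]|[p d1 d2]]]; exists F; [left|right]; split=> //; apply: h. Qed.

Lemma bracket_split_outer P i U U' W V V' C C' :
  (forall F, der (U ++ Ty F :: V) C -> der (U' ++ Ty F :: V') C') ->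
  bracket_split P i U W V C -> bracket_split P i U' W V' C'.
Proof. by move=> h [F [[p d1 d2]|[p d1 d2]]]; exists F; [left|right]; split=> //; apply: h. Qed.

(** A balanced proper prefix would leave the first bracket open. *)
Lemma block_split i W K1 K2 :
  bal W -> Op i :: W ++ [:: Cl] = K1 ++ K2 -> bal K1 -> K1 <> [::] -> K2 <> [::] -> False.
Proof.
case: K1 => [//|x K1] bW /= [<- h] b1 _ n2.
suff [Y eW] : exists Y, W = K1 ++ Y by apply: (@not_bal_Op i K1 Y) b1; rewrite -eW.
case: (cat_split h) => [[e [eK e2]]|[y [e [eW _]]]]; last by exists (y :: e).
exists [::]; case: e e2 eK => [|y [|? ?]] /=; first by rewrite !cats0.
  by case: K2 n2 {h}.
by [].
Qed.

Ltac all_norm := do 3!rewrite ?all_cat /=.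
Ltac all_by := all_norm;
  repeat match goal with
  | |- context [all ?p ?s] => case: (all p s) => //=
  | |- context [?P ?A && _] => case: (P A) => //=
  end.

(** Read upwards, a cut-free derivation has one rule that removes the given pair of
    brackets.  It is either the right rule for [Dia], whose premise is [der W F], or
    the left rule for [Box], above which the segment has become the type [F] while
    [W] was [Box i F].  The rules below it act inside [W] or outside the brackets,
    since no balanced segment cuts through a matching pair, and they can be
    replayed below either half of the split. *)
Lemma bracket_splitP P i U W V C :
  subtype_closed P -> bal W -> der (U ++ Op i :: W ++ Cl :: V) C ->
  all (ty_in P) (U ++ Op i :: W ++ Cl :: V) -> P C -> bracket_split P i U W V C.
Proof.
move=> cP bW d; have bK := bal_br i bW; have nK : Op i :: W ++ [:: Cl] <> [::] by [].
have eW : U ++ (Op i :: W ++ [:: Cl]) ++ V = U ++ Op i :: W ++ Cl :: V by cat_norm.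
move: (U ++ Op i :: W ++ Cl :: V) eW d => Z eW d.
elim: d U W V bW bK nK eW => {Z C}
 [p|G U0 V0 A B C dG IG dC IC|Z A B nZ dB IB|G U0 V0 A B C dG IG dC IC|Z A B nZ dB IB
 |U0 V0 A B C dC IC|G D A B dG IG dD ID|U0 V0 j A C dC IC|G j A dA IA|U0 V0 j A C dC IC|Z j A nZ bZ dA IA]
 U W V bW bK nK eW aP pC.
- by case: U eW {aP} => [|x [|? ?]].
- have [pA pB] : P A /\ P B by apply: (cP (Ldiv A B)); move: aP; all_by.
  have aC : all (ty_in P) (U0 ++ Ty B :: V0) by move: aP; all_norm; rewrite pB; all_by.
  have aG : all (ty_in P) G by move: aP; all_by.
  case: (arg_leftP bK (der_bal dG) eW) => 
   [V' eU0 eV|U' eU eV0|G1 G2 eG eU eV|K1 K2 eK eU0 eV0|K1 G1 G2 eK eU0 eG eV n1 n2 b1 b2|G1 G2 K2 eK eG eU eV0 n1 b1 b2 b3]; subst.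
  + apply: (@bracket_split_outer P i U U W (V' ++ Ty B :: V0) _ C C).
      move=> F d; have := @d_ldl G (U ++ Ty F :: V') V0 A B C dG; rewrite -!catA; exact.
    by apply: IC => //; cat_norm.
  + apply: (@bracket_split_outer P i (U0 ++ Ty B :: U') _ W V _ C C).
      by move=> F d; rewrite -catA /= in d; der_by (d_ldl dG d).
    by apply: IC => //; cat_norm.
  + apply: (@bracket_split_outer P i G1 _ W G2 _ A C); last exact: IG.
    by move=> F d; der_by (d_ldl d dC).
  + have bM : bal (G ++ [:: Ty (Ldiv A B)]) by apply: bal_cat (der_bal dG) _.
    have nM : G ++ [:: Ty (Ldiv A B)] <> [::] by [].
    have {}eK : K1 ++ (G ++ [:: Ty (Ldiv A B)]) ++ K2 = Op i :: W ++ [:: Cl] by rewrite eK -catA.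
    case: (factor_bracket bM nM bW eK) => [[e _ _]|[W1 [W2 [e eK1 eK2]]]].
      (* The active part ends with a type, the bracketed segment with [Cl]. *)
      by have := congr1 (last Cl) e; rewrite /= !last_cat.
    subst; apply: (@bracket_split_inner P i _ (W1 ++ Ty B :: W2)).
      by move=> F d; der_by (d_ldl dG d).
    have bW' : bal (W1 ++ Ty B :: W2) by apply: (@bal_subst W1 _ [:: Ty B] W2 bM).
    apply: IC => //; [exact: bal_br|cat_norm].
  + by case: (block_split bW eK).
  + by case: (block_split bW eK) => // e; rewrite e in eK.
- have [pA pB] := cP _ pC.
  apply: (@bracket_split_outer P i (Ty A :: U) U W V V B).
    by move=> F d; apply: d_ldr.
  by apply: IB; rewrite /= ?pA // -eW.
- have [pA pB] : P A /\ P B by apply: (cP (Rdiv B A)); move: aP; all_by.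
  have aC : all (ty_in P) (U0 ++ Ty B :: V0) by move: aP; all_norm; rewrite pB; all_by.
  have aG : all (ty_in P) G by move: aP; all_by.
  case: (arg_rightP bK (der_bal dG) eW) =>
   [V' eU0 eV|U' eU eV0|G1 G2 eG eU eV|K1 K2 eK eU0 eV0|G1 G2 K2 eK eG eU eV0 n1 n2 b1 b2|K1 G1 G2 eK eU0 eG eV n1 b1 b2 b3]; subst.
  + apply: (@bracket_split_outer P i U U W (V' ++ Ty B :: V0) _ C C).
      move=> F d; have := @d_rdl G (U ++ Ty F :: V') V0 A B C dG; rewrite -!catA; exact.
    by apply: IC => //; cat_norm.
  + apply: (@bracket_split_outer P i (U0 ++ Ty B :: U') _ W V _ C C).
      by move=> F d; rewrite -catA /= in d; der_by (d_rdl dG d).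
    by apply: IC => //; cat_norm.
  + apply: (@bracket_split_outer P i G1 _ W G2 _ A C); last exact: IG.
    by move=> F d; der_by (d_rdl d dC).
  + have bM : bal (Ty (Rdiv B A) :: G) by apply: der_bal dG.
    have nM : Ty (Rdiv B A) :: G <> [::] by [].
    case: (factor_bracket bM nM bW (esym eK)) => [[//]|[W1 [W2 [e eK1 eK2]]]].
    subst; apply: (@bracket_split_inner P i _ (W1 ++ Ty B :: W2)).
      by move=> F d; der_by (d_rdl dG d).
    have bW' : bal (W1 ++ Ty B :: W2) by apply: (@bal_subst W1 _ [:: Ty B] W2 bM).
    apply: IC => //; [exact: bal_br|cat_norm].
  + by case: (block_split bW eK).
  + case: (@block_split i W (K1 ++ [:: Ty (Rdiv B A)]) G1) => //.
    * by rewrite eK -catA.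
    * exact: bal_cat b1 _.
    * move=> e; have := congr1 (last Cl) eK.
      by rewrite e /= !last_cat.
- have [pA pB] := cP _ pC.
  apply: (@bracket_split_outer P i U U W (V ++ [:: Ty A]) V B).
    by move=> F d; apply: d_rdr => //; der_by d.
  by apply: IB => //; [rewrite -eW; cat_norm|rewrite all_cat aP /= pA].
- have [pA pB] : P A /\ P B by apply: (cP (Prod A B)); move: aP; all_by.
  have aC : all (ty_in P) (U0 ++ Ty A :: Ty B :: V0) by move: aP; all_norm; rewrite pA pB; all_by.
  case: (factor_cons eW) => [[U' [-> eV0]]|[K1 [K2 [eK eU0 eV0]]]|[V' [eU0 ->]]]; subst.
  + apply: (@bracket_split_outer P i (U0 ++ Ty A :: Ty B :: U') _ W V _ C C).
      by move=> F d; rewrite -catA /= in d; der_by (d_prl d).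
    by apply: IC => //; cat_norm.
  + have bM : bal [:: Ty (Prod A B)] by [].
    case: (@factor_bracket K1 [:: Ty (Prod A B)] K2 W i) => // [[//]|[W1 [W2 [e eK1 eK2]]]].
    subst; apply: (@bracket_split_inner P i _ (W1 ++ Ty A :: Ty B :: W2)).
      by move=> F d; der_by (d_prl d).
    have bW' : bal (W1 ++ Ty A :: Ty B :: W2) by apply: (@bal_subst W1 _ [:: Ty A; Ty B] W2 bM).
    apply: IC => //; [exact: bal_br|cat_norm].
  + apply: (@bracket_split_outer P i U U W (V' ++ Ty A :: Ty B :: V0) _ C C).
      move=> F d; have := @d_prl (U ++ Ty F :: V') V0 A B C; rewrite -!catA; exact.
    by apply: IC => //; cat_norm.
- have [pA pB] := cP _ pC; move: aP; rewrite all_cat => /andP[aG aD].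
  case: (factor_cat bK (der_bal dG) eW) => [[U' [-> eD]]|[V' [eG ->]]|[K1 [K2 [eK n1 n2 b1 [b2 [eG eD]]]]]]; subst.
  + apply: (@bracket_split_outer P i U' _ W V _ B); last exact: ID.
    by move=> F d; der_by (d_prr dG d).
  + apply: (@bracket_split_outer P i U _ W V' _ A); last exact: IG.
    by move=> F d; der_by (d_prr d dD).
  + by case: (block_split bW eK).
- have pA : P A by apply: (cP (Dia j A)); move: aP; all_by.
  have aC : all (ty_in P) (U0 ++ Op j :: Ty A :: Cl :: V0) by move: aP; all_norm; rewrite pA; all_by.
  case: (factor_cons eW) => [[U' [-> eV0]]|[K1 [K2 [eK eU0 eV0]]]|[V' [eU0 ->]]]; subst.
  + apply: (@bracket_split_outer P i (U0 ++ Op j :: Ty A :: Cl :: U') _ W V _ C C).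
      by move=> F d; rewrite -catA /= in d; der_by (d_dil d).
    by apply: IC => //; cat_norm.
  + have bM : bal [:: Ty (Dia j A)] by [].
    case: (@factor_bracket K1 [:: Ty (Dia j A)] K2 W i) => // [[//]|[W1 [W2 [e eK1 eK2]]]].
    subst; apply: (@bracket_split_inner P i _ (W1 ++ Op j :: Ty A :: Cl :: W2)).
      by move=> F d; der_by (d_dil d).
    have bW' : bal (W1 ++ Op j :: Ty A :: Cl :: W2) by apply: (@bal_subst W1 _ [:: Op j; Ty A; Cl] W2 bM).
    apply: IC => //; [exact: bal_br|cat_norm].
  + apply: (@bracket_split_outer P i U U W (V' ++ Op j :: Ty A :: Cl :: V0) _ C C).
      move=> F d; have := @d_dil (U ++ Ty F :: V') V0 j A C; rewrite -!catA; exact.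
    by apply: IC => //; cat_norm.
- have pA := cP _ pC.
  case: (factor_bracket bK nK (der_bal dA) eW) => [[eK eU eV]|[U' [V' [eG eU eV]]]]; subst.
  + case: eK => ei /(@bal_cons_Cl_inj _ _ _ _ bW (der_bal dA))[eG _]; subst.
    by exists A; left; split=> //; apply: der_id.
  + apply: (@bracket_split_outer P i U' _ W V' _ A).
      by move=> F d; der_by (d_dir j d).
    by apply: IA => //; move: aP; all_by.
- have pA : P A by apply: (cP (Box j A)); move: aP; all_by.
  have pX : P (Box j A) by move: aP; all_by.
  have aC : all (ty_in P) (U0 ++ Ty A :: V0) by move: aP; all_norm; rewrite pA; all_by.
  case: (factor_box bK nK eW) => [[U' [-> eV0]]|[//]|[K1 [K2 [eK eU0 eV0]]]|[V' [eU0 ->]]]; subst.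
  + apply: (@bracket_split_outer P i (U0 ++ Ty A :: U') _ W V _ C C).
      by move=> F d; rewrite -catA /= in d; der_by (d_bol j d).
    by apply: IC => //; cat_norm.
  + have bM : bal [:: Op j; Ty (Box j A); Cl] by [].
    case: (@factor_bracket K1 [:: Op j; Ty (Box j A); Cl] K2 W i) => // [[e eK1 eK2]|[W1 [W2 [e eK1 eK2]]]].
      subst; case: e => ei; rewrite -[[:: Ty _; Cl]]/([:: Ty (Box j A)] ++ [:: Cl]).
      case/(bal_cons_Cl_inj (der_bal (der_id _)) bW) => <- _; subst.
      by exists A; right; split; [|apply: der_id|move: dC; cat_norm].
    subst; apply: (@bracket_split_inner P i _ (W1 ++ Ty A :: W2)).
      by move=> F d; der_by (d_bol j d).
    have bW' : bal (W1 ++ Ty A :: W2) by apply: (@bal_subst W1 _ [:: Ty A] W2 bM).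
    apply: IC => //; [exact: bal_br|cat_norm].
  + apply: (@bracket_split_outer P i U U W (V' ++ Ty A :: V0) _ C C).
      move=> F d; have := @d_bol (U ++ Ty F :: V') V0 j A C; rewrite -!catA; exact.
    by apply: IC => //; cat_norm.
- have pA := cP _ pC.
  apply: (@bracket_split_outer P i (Op j :: U) U W (V ++ [:: Cl]) V A).
    move=> F d; apply: d_bor; [by []| |by der_by d].
    by rewrite -eW in bZ; exact: (@bal_subst U _ [:: Ty F] V bK (bal_Ty F bal_nil) bZ).
  by apply: IA => //; [rewrite -eW; cat_norm|rewrite /= all_cat aP].
Qed.

(** * Thin sequents *)

Fixpoint relabel (f : nat -> nat) (A : itp) : itp :=
  match A with
  | Prim i => Prim (f i)
  | Ldiv A B => Ldiv (relabel f A) (relabel f B)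
  | Rdiv B A => Rdiv (relabel f B) (relabel f A)
  | Prod A B => Prod (relabel f A) (relabel f B)
  | Dia i A => Dia (f i) (relabel f A)
  | Box i A => Box (f i) (relabel f A)
  end.

Definition relabel_sym f (s : sym) : sym :=
  match s with Op i => Op (f i) | Cl => Cl | Ty A => Ty (relabel f A) end.

Notation relabelw f := (map (relabel_sym f)).

Lemma run_relabel f n W : run n (relabelw f W) = run n W.
Proof. by elim: W n => [|[i||A] W IH] [|n] //=. Qed.

Lemma bal_relabel f W : bal (relabelw f W) <-> bal W.
Proof. by rewrite /bal run_relabel. Qed.

(** Derivability is stable under identification of indices, so nothing is lost by
    working with thin sequents. *)
Lemma der_relabel f W A : der W A -> der (relabelw f W) (relabel f A).
Proof.
elim=> {W A} /=.
- by move=> p; apply: d_ax.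
- move=> G U V A B C _ dG _; rewrite !map_cat /= => d; exact: d_ldl.
- by move=> [|x W] // A B _ _ d; apply: d_ldr.
- move=> G U V A B C _ dG _; rewrite !(map_cat, map_cons) /= => d; exact: d_rdl.
- by move=> [|x W] // A B _ _; rewrite map_cat => d; apply: d_rdr.
- move=> U V A B C _; rewrite !map_cat /= => d; exact: d_prl.
- by move=> G D A B _ d1 _ d2; rewrite map_cat; apply: d_prr.
- move=> U V i A C _; rewrite !map_cat /= => d; exact: d_dil.
- by move=> G i A _ d; rewrite map_cat; apply: d_dir.
- move=> U V i A C _; rewrite !map_cat /= => d; exact: d_bol.
- move=> [|x W] // i A _ bW _; rewrite map_cat => d; apply: d_bor => //.
  exact/bal_relabel.
Qed.

Lemma gens_relabel f A : gens (relabel f A) = map f (gens A).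
Proof. by elim: A => //= [A -> B ->|B -> A ->|A -> B ->|i A ->|i A ->] //; rewrite map_cat. Qed.

Lemma word_gens_relabel f W : word_gens (relabelw f W) = map f (word_gens W).
Proof.
elim: W => //= s W IH; rewrite !word_gens_cons IH map_cat; congr (_ ++ _).
by case: s => //= A; apply: gens_relabel.
Qed.

Lemma relabel_comp f g A : relabel f (relabel g A) = relabel (f \o g) A.
Proof. by elim: A => //= [A -> B ->|B -> A ->|A -> B ->|i A ->|i A ->]. Qed.

Lemma relabelw_comp f g W : relabelw f (relabelw g W) = relabelw (f \o g) W.
Proof. by rewrite -map_comp; apply: eq_map => -[i||A] //=; rewrite relabel_comp. Qed.

Lemma eq_relabel f g : f =1 g -> relabel f =1 relabel g.
Proof. by move=> e; elim=> //= [i|A -> B ->|B -> A ->|A -> B ->|i A ->|i A ->]; rewrite ?e. Qed.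

Lemma eq_relabelw f g : f =1 g -> relabelw f =1 relabelw g.
Proof. by move=> e; apply: eq_map => -[i||A] //=; rewrite ?e // (eq_relabel e). Qed.

(** Two is the number of occurrences that an axiom has. *)
Definition thin W A := forall n : nat, woccs n W + occ n A <= 2.

Definition thinning W A := exists f W' A',
  [/\ der W' A', thin W' A', relabelw f W' = W & relabel f A' = A].

Lemma count_map_double n s :
  count_mem n (map double s) = if odd n then 0 else count_mem n./2 s.
Proof. elim: s => [|x s /= ->]; first by case: ifP. by case: ifP; lia. Qed.

Lemma count_map_doubleS n s :
  count_mem n (map (fun k => k.*2.+1) s) = if odd n then count_mem n./2 s else 0.
Proof. elim: s => [|x s /= ->]; first by case: ifP. by case: ifP; lia. Qed.

Lemma count_map_S n s :
  count_mem n (map S s) = if n is n'.+1 then count_mem n' s else 0.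
Proof. by elim: s => [|x s /= ->]; case: n => //= n; rewrite eqSS. Qed.

Lemma map_eq_cat (S T : Type) (f : S -> T) s a b :
  map f s = a ++ b -> exists a' b', [/\ s = a' ++ b', map f a' = a & map f b' = b].
Proof.
elim: a s => [|x a IH] s /=; first by exists [::], s.
by case: s => //= y s [<- /IH[a' [b' [-> <- <-]]]]; exists (y :: a'), b'.
Qed.

Lemma relabel_eq_cons f W s V : relabelw f W = s :: V ->
  exists s' V', [/\ W = s' :: V', relabel_sym f s' = s & relabelw f V' = V].
Proof. by case: W => //= s' V' [<- <-]; exists s', V'. Qed.

Lemma relabel_eq_factor f W U s V : relabelw f W = U ++ s :: V ->
  exists U' s' V', [/\ W = U' ++ s' :: V', relabelw f U' = U, relabel_sym f s' = s
                     & relabelw f V' = V].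
Proof.
move=> h; have [U' [X [-> eU eX]]] := map_eq_cat h.
by have [s' [V' [-> es eV]]] := relabel_eq_cons eX; exists U', s', V'.
Qed.

(** The first sequent gets the even indices and the second the odd ones, so that the
    joint count stays at most two. *)
Lemma thinning2 W A X B : thinning W A -> thinning X B ->
  exists f W' A' X' B', [/\ der W' A' /\ der X' B',
    forall n : nat, woccs n W' + occ n A' + (woccs n X' + occ n B') <= 2,
    relabelw f W' = W /\ relabel f A' = A & relabelw f X' = X /\ relabel f B' = B].
Proof.
move=> [f [W' [A' [d1 t1 <- <-]]]] [g [X' [B' [d2 t2 <- <-]]]].
pose S2 k := k.*2.+1.
exists (fun n => if odd n then g n./2 else f n./2).
exists (relabelw double W'), (relabel double A'), (relabelw S2 X'), (relabel S2 B').
split; first by split; apply: der_relabel.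
- move=> n; rewrite !word_gens_relabel !gens_relabel !count_map_double !count_map_doubleS.
  by have := t1 n./2; have := t2 n./2; case: ifP => _; lia.
- rewrite relabelw_comp relabel_comp; split; [apply: eq_relabelw|apply: eq_relabel] => n /=;
  by rewrite odd_double doubleK.
- rewrite relabelw_comp relabel_comp; split; [apply: eq_relabelw|apply: eq_relabel] => n /=;
  by rewrite odd_double /= uphalf_double.
Qed.

(** Shifting all indices by one makes room for a fresh index 0. *)
Lemma thinning_fresh i W A : thinning W A ->
  exists f W' A', [/\ der W' A' /\ f 0 = i,
    forall n : nat, (0 == n) + (0 == n) + woccs n W' + occ n A' <= 2,
    relabelw f W' = W & relabel f A' = A].
Proof.
move=> [f [W' [A' [d t <- <-]]]].
exists (fun n => if n is n'.+1 then f n' else i), (relabelw S W'), (relabel S A').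
split; rewrite ?relabelw_comp ?relabel_comp; [by split=> //; apply: der_relabel| |exact: eq_relabelw|exact: eq_relabel].
move=> n; rewrite !word_gens_relabel !gens_relabel !count_map_S.
by case: n => // n; apply: t.
Qed.

Ltac thin_by := let n := fresh "n" in intro n; match goal with h : forall _ : _, is_true _ |- _ => move: (h n) | h : thin _ _ |- _ => move: (h n) end;
  rewrite ?gensE; lia.

(** Indices enter a derivation in pairs: at an axiom, and where a modality appears
    together with its bracket ([d_dir] and [d_bol]).  Give each pair an index of its
    own.  All other rules merely move indices between brackets and types. *)
Lemma thin_exists W A : der W A -> thinning W A.
Proof.
elim=> {W A}.
- by move=> p; exists (fun=> p), [:: Ty (Prim 0)], (Prim 0); split=> //; [apply: d_ax|move=> [|n]].
- move=> G U V A B C _ tG _ /(thinning2 tG)[f [G' [A' [W' [C' [[dG dC] t [<- <-] [eW <-]]]]]]].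
  have [U' [[i||B'] [V' [eW' <- //= [<-] <-]]]] := relabel_eq_factor eW; subst.
  exists f, (U' ++ G' ++ Ty (Ldiv A' B') :: V'), C'; split; [exact: d_ldl|thin_by|by rewrite !map_cat|by []].
- move=> W A B nW _ [f [Z [B' [dB t eZ <-]]]].
  have [[i||A'] [W' [e //= [eA] eW]]] := relabel_eq_cons eZ; subst.
  exists f, W', (Ldiv A' B'); split=> //; [|thin_by].
  by apply: d_ldr dB; move=> e; rewrite e in nW.
- move=> G U V A B C _ tG _ /(thinning2 tG)[f [G' [A' [W' [C' [[dG dC] t [<- <-] [eW <-]]]]]]].
  have [U' [[i||B'] [V' [eW' <- //= [<-] <-]]]] := relabel_eq_factor eW; subst.
  exists f, (U' ++ Ty (Rdiv B' A') :: G' ++ V'), C'; split; [exact: d_rdl|thin_by|by rewrite map_cat /= map_cat|by []].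
- move=> W A B nW _ [f [Z [B' [dB t eZ <-]]]].
  have [W' [s [[|? ?] [e eW es eV]]]] := relabel_eq_factor eZ; last by [].
  case: s e es => // A' e [eA]; subst.
  exists f, W', (Rdiv B' A'); split=> //; [|thin_by].
  by apply: d_rdr dB; move=> e; rewrite e in nW.
- move=> U V A B C _ [f [Z [C' [d t eZ <-]]]].
  have [U' [[?||A'] [Z' [e <- //= [<-] eZ1]]]] := relabel_eq_factor eZ.
  have [[?||B'] [V' [e1 //= [<-] <-]]] := relabel_eq_cons eZ1; subst.
  by exists f, (U' ++ Ty (Prod A' B') :: V'), C'; split; [exact: d_prl|thin_by|rewrite map_cat|].
- move=> G D A B _ tG _ /(thinning2 tG)[f [G' [A' [D' [B' [[dG dD] t [<- <-] [<- <-]]]]]]].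
  by exists f, (G' ++ D'), (Prod A' B'); split; [exact: d_prr|thin_by|rewrite map_cat|].
- move=> U V i A C _ [f [Z [C' [d t eZ <-]]]].
  have [U' [[j||?] [Z' [e <- //= [<-] eZ1]]]] := relabel_eq_factor eZ.
  have [[?||A'] [Z2 [e1 //= [<-] eZ2]]] := relabel_eq_cons eZ1.
  have [[?||?] [V' [e2 //= _ <-]]] := relabel_eq_cons eZ2; subst.
  by exists f, (U' ++ Ty (Dia j A') :: V'), C'; split; [exact: d_dil|thin_by|rewrite map_cat|].
- move=> G i A _ /(thinning_fresh i)[f [G' [A' [[d <-] t <- <-]]]].
  exists f, (Op 0 :: G' ++ [:: Cl]), (Dia 0 A'); split; [exact: d_dir|thin_by|by rewrite /= map_cat|by []].
- move=> U V i A C _ /(thinning_fresh i)[f [Z [C' [[d <-] t eZ <-]]]].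
  have [U' [[j||A'] [V' [e <- //= [<-] <-]]]] := relabel_eq_factor eZ; subst.
  exists f, (U' ++ Op 0 :: Ty (Box 0 A') :: Cl :: V'), C'; split; [exact: d_bol|thin_by|by rewrite map_cat|by []].
- move=> W i A nW bW _ [f [Z [A' [d t eZ <-]]]].
  have [[j||?] [Z' [e //= [ei] eZ']]] := relabel_eq_cons eZ.
  have [W' [s [[|? ?] [e' eW es eV]]]] := relabel_eq_factor eZ'; last by [].
  case: s e' es => // e' _; subst.
  exists f, W', (Box j A'); split=> //; [|thin_by].
  apply: d_bor d; first by move=> e; rewrite e in nW.
  exact/bal_relabel/bW.
Qed.

(** * Reduction in the free group *)

Definition letter : Type := (bool * nat)%type.

Definition linv (x : letter) : letter := (~~ x.1, x.2).

Definition ginv (u : seq letter) : seq letter := rev (map linv u).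

Definition push (x : letter) (w : seq letter) : seq letter :=
  if w is y :: w' then if y == linv x then w' else x :: w else [:: x].

(** The free group acts on reduced words by pushing letters and cancelling.  Two
    words represent the same element when they act alike, so no quotient is formed. *)
Definition act (u w : seq letter) : seq letter := foldr push w u.

Definition reduced (w : seq letter) : bool := sorted (fun x y => y != linv x) w.

Lemma linvK : involutive linv.
Proof. by case=> b n; rewrite /linv negbK. Qed.

Lemma ginvK : involutive ginv.
Proof. by move=> u; rewrite /ginv map_rev revK mapK //; apply: linvK. Qed.

Lemma size_ginv u : size (ginv u) = size u.
Proof. by rewrite size_rev size_map. Qed.

Lemma act_cat u v w : act (u ++ v) w = act u (act v w).
Proof. exact: foldr_cat. Qed.

Lemma ginv_cons x u : ginv (x :: u) = ginv u ++ [:: linv x].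
Proof. by rewrite /ginv /= rev_cons cats1. Qed.

Lemma ginv_cat u v : ginv (u ++ v) = ginv v ++ ginv u.
Proof. by rewrite /ginv map_cat rev_cat. Qed.

Lemma reduced_behead x w : reduced (x :: w) -> reduced w.
Proof. exact: path_sorted. Qed.

Lemma push_reduced x w : reduced w -> reduced (push x w).
Proof.
case: w => [|y w] //= rw; case: ifP => [_|/negbT ne]; first exact: path_sorted rw.
by rewrite /= ne.
Qed.

Lemma act_reduced u w : reduced w -> reduced (act u w).
Proof. by move=> rw; elim: u => //= x u; apply: push_reduced. Qed.

Lemma pushK x w : reduced w -> push (linv x) (push x w) = w.
Proof.
case: w => [|y w] /=; first by rewrite linvK eqxx.
case: eqP => [->|_] /=; last by rewrite linvK eqxx.
by case: w => [|z w] //=; rewrite !linvK; case: eqP.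
Qed.

Lemma actK u w : reduced w -> act (ginv u) (act u w) = w.
Proof.
elim: u w => //= x u IH w rw.
by rewrite ginv_cons act_cat /= pushK ?IH //; apply: act_reduced.
Qed.

Lemma actVK u w : reduced w -> act u (act (ginv u) w) = w.
Proof. by move=> rw; rewrite -{1}[u]ginvK actK. Qed.

Lemma push_id x w : reduced (x :: w) -> push x w = x :: w.
Proof. by case: w => //= y w /andP[/negbTE ->]. Qed.

Lemma act_id u w : reduced (u ++ w) -> act u w = u ++ w.
Proof.
elim: u => //= x u IH r; rewrite IH ?push_id //; exact: reduced_behead r.
Qed.

Lemma act_nil u : reduced u -> act u [::] = u.
Proof. by move=> r; rewrite act_id cats0. Qed.

Lemma act_push x u w : reduced u -> reduced w -> act (push x u) w = push x (act u w).
Proof.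
case: u => //= y u r rw; case: eqP => [->|//].
by rewrite -{1}[x]linvK pushK //; apply: act_reduced.
Qed.

Lemma act_act u v w : reduced v -> reduced w -> act (act u v) w = act u (act v w).
Proof.
move=> rv rw; elim: u => //= x u IH; rewrite act_push ?IH //; exact: act_reduced.
Qed.

Lemma reduced_cat u v : reduced (u ++ v) -> reduced u /\ reduced v.
Proof.
case: u => [|x u]; first by [].
by rewrite /reduced /= cat_path => /andP[-> /path_sorted].
Qed.

Lemma reduced_ginv u : reduced (ginv u) = reduced u.
Proof.
rewrite /reduced /ginv rev_sorted sorted_map; apply: eq_sorted => x y /=.
rewrite linvK; apply/idP/idP; apply: contra => /eqP ->; by rewrite ?linvK.
Qed.

Lemma size_act_ginv u : size (act (ginv u) [::]) = size (act u [::]).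
Proof.
set w := act u [::]; have rw : reduced w by apply: act_reduced.
have rz : reduced (act (ginv w) [::]) by apply: act_reduced.
have e : act u (act (ginv w) [::]) = [::].
  by rewrite -[act (ginv w) _]/(act [::] (act (ginv w) [::])) -act_act // actVK.
rewrite -{1}e actK // act_nil ?size_ginv //.
by rewrite reduced_ginv.
Qed.

(** [c] is the part of [u] that cancels against [v]. *)
Lemma act_overlap u v : reduced u -> reduced v -> exists p c q,
  [/\ u = p ++ c, v = ginv c ++ q, act u v = p ++ q & reduced (p ++ q)].
Proof.
move=> ru rv; elim/last_ind: u v ru rv => [|u x IH] v ru rv.
  by exists [::], [::], v.
have ru' : reduced u by move: ru; rewrite -cats1 => /reduced_cat[].
case: v rv => [|y v] rv.
  by exists (rcons u x), [::], [::]; split; rewrite ?cats0 //; apply: act_nil.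
have [e|ne] := eqVneq y (linv x).
  have [p [c [q [e1 e2 e3 r3]]]] := IH v ru' (reduced_behead rv).
  exists p, (rcons c x), q; split=> //.
  - by rewrite e1 rcons_cat.
  - by rewrite -cats1 ginv_cat /= e e2.
  - by rewrite -cats1 act_cat /= e eqxx.
have r : reduced (rcons u x ++ y :: v).
  move: ru rv; rewrite /reduced -cats1 -catA /=.
  case: u {ru' IH} => [|z u] /=; first by rewrite ne.
  by rewrite !cat_path /= ne => /andP[-> /andP[-> _]].
exists (rcons u x), [::], (y :: v); split=> //; [by rewrite cats0|exact: act_id].
Qed.

Definition gprod (us : seq (seq letter)) : seq letter := foldr act [::] us.

(** For reduced words: less than half of either one cancels. *)
Definition lengthening (u v : seq letter) : bool :=
  maxn (size u) (size v) < size (act u v).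

Lemma gprod_reduced us : reduced (gprod us).
Proof. by elim: us => //= u us IH; apply: act_reduced. Qed.

(** Since less than half of each factor cancels on either side, the cancellations
    at the two ends of a factor do not meet, and more than half of the first factor
    survives in the product. *)
Lemma gprod_lengthening u us : all reduced (u :: us) -> u <> [::] ->
  path lengthening u us ->
  exists x y t, [/\ u = x ++ y, size u < 2 * size x & gprod (u :: us) = x ++ t].
Proof.
elim: us u => [|v us IH] u /=.
  rewrite andbT => ru nu _; exists u, [::], [::]; rewrite !cats0 act_nil //.
  by split=> //; case: u nu {ru} => //= *; lia.
move=> /and3P[ru rv rus] nu /andP[luv pv].
have nv : v <> [::] by move=> e; move: luv; rewrite e /lengthening act_nil //=; lia.
have [x' [y' [t' [ev sx' eP]]]] := IH v (introT andP (conj rv rus)) nv pv.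
have [p [c [q [eu ev' euv rpq]]]] := act_overlap ru rv.
move: luv; rewrite /lengthening euv eu ev' !size_cat size_ginv => luv.
(* What [u] cancels in [v] is less than half of [v], hence a proper prefix of the
   part [x'] of [v] that survives the product with the later factors. *)
have [[|z q1] [ex eq]] : exists q1, x' = ginv c ++ q1 /\ q = q1 ++ y'.
- case: (cat_split (etrans (esym ev') ev)) => [[e [-> ->]]|[z [e [eg _]]]]; first by exists e.
  have := congr1 size eg; rewrite size_ginv size_cat /= => sc.
  have := congr1 size ev'; rewrite size_cat size_ginv; lia.
- have := congr1 size ex; have := congr1 size ev'; rewrite !size_cat size_ginv /=; lia.
exists p, c, (z :: q1 ++ t'); split=> //; first by lia.
have -> : act (ginv c ++ q) (gprod us) = x' ++ t' by rewrite -ev' -eP.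
have rP : reduced (x' ++ t') by rewrite -eP; apply: (gprod_reduced (v :: us)).
rewrite ex -catA in rP.
have [_ rq] := reduced_cat rP.
rewrite act_cat ex -catA -(act_id rP) actVK // act_id //.
move: rpq rq; rewrite eq /reduced; case: p {eu luv euv} => //= a p.
by rewrite cat_path /= => /and3P[ap az _] zp; rewrite cat_path /= ap az.
Qed.

Lemma split_not_sorted (T : Type) (r : rel T) s : ~~ sorted r s ->
  exists a x y b, s = a ++ x :: y :: b /\ ~~ r x y.
Proof.
elim: s => // x [|y s] IH //=; rewrite negb_and; case: (boolP (r x y)) => /= [_|n _].
  by case/IH => a [x' [y' [b [-> h]]]]; exists (x :: a), x', y', b.
by exists [::], x, y, s.
Qed.

(** The combinatorial core of Pentus's argument. *)
Lemma gprod_nil_split u v us : all reduced [:: u, v & us] -> gprod [:: u, v & us] = [::] ->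
  exists a x y b, [:: u, v & us] = a ++ x :: y :: b /\ size (act x y) <= maxn (size x) (size y).
Proof.
move=> r e; case: (boolP (sorted lengthening [:: u, v & us])) => [p|/split_not_sorted].
  have nu : u <> [::].
    move=> eu; move: p r; rewrite eu /= /lengthening => /andP[+ _] /andP[rv _].
    by rewrite /=; lia.
  have [x [y [t [eu sx]]]] := gprod_lengthening r nu p.
  by rewrite e; case: x eu sx => //=; lia.
by case=> a [x [y [b [-> h]]]]; exists a, x, y, b; split=> //; rewrite leqNgt.
Qed.

(** * Thin sequents without brackets *)

(** With an opening bracket read as a generator and a closing one as 1, [Dia i A] is
    read as the bracketed [A], and [Box i A] as the value that turns into [A] once it
    is bracketed. *)
Fixpoint gval (A : itp) : seq letter :=
  match A with
  | Prim i => [:: (true, i)]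
  | Ldiv A B => ginv (gval A) ++ gval B
  | Rdiv B A => gval B ++ ginv (gval A)
  | Prod A B => gval A ++ gval B
  | Dia i A => (true, i) :: gval A
  | Box i A => (false, i) :: gval A
  end.

Definition gval_sym (s : sym) : seq letter :=
  match s with Op i => [:: (true, i)] | Cl => [::] | Ty A => gval A end.

Definition gvalw (W : word) : seq letter := flatten (map gval_sym W).

Lemma gvalw_cat U V : gvalw (U ++ V) = gvalw U ++ gvalw V.
Proof. by rewrite /gvalw map_cat flatten_cat. Qed.

Lemma gvalw_cons s V : gvalw (s :: V) = gval_sym s ++ gvalw V.
Proof. by []. Qed.

#[local] Hint Extern 0 (is_true (reduced _)) =>
  do ?apply: act_reduced; (assumption || reflexivity) : core.

Lemma der_act W A : der W A -> forall w, reduced w -> act (gvalw W) w = act (gval A) w.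
Proof.
elim=> {W A}.
- by [].
- move=> G U V A B C _ eG _ eC w rw; rewrite -eC // !gvalw_cat !gvalw_cons /= !act_cat; congr act.
  by rewrite eG // actVK.
- move=> W A B _ _ eB w rw; rewrite act_cat -eB // gvalw_cons act_cat /= actK //.
- move=> G U V A B C _ eG _ eC w rw.
  rewrite -eC // gvalw_cat gvalw_cons gvalw_cat [in RHS]gvalw_cat gvalw_cons /= !act_cat; congr act.
  by rewrite eG // actK //.
- move=> W A B _ _ eB w rw; rewrite act_cat.
  have /= := eB (act (ginv (gval A)) w) (act_reduced _ rw).
  by rewrite gvalw_cat act_cat gvalw_cons /= cats0 actVK //.
- by move=> U V A B C _ eC w rw; rewrite -eC // !gvalw_cat !gvalw_cons /= -!catA.
- move=> G D A B _ eG _ eD w rw; rewrite gvalw_cat !act_cat eD // eG //.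
- by move=> U V i A C _ eC w rw; rewrite -eC // !gvalw_cat !gvalw_cons.
- by move=> G i A _ eG w rw; rewrite gvalw_cons gvalw_cat /= cats0 eG //.
- move=> U V i A C _ eC w rw; rewrite -eC // !gvalw_cat !gvalw_cons /= !act_cat; congr act => /=.
  by rewrite -[(true, i)]/(linv (false, i)) pushK // act_cat.
- move=> W i A _ _ _ eA w rw; rewrite /= -eA // gvalw_cons gvalw_cat /= cats0.
  rewrite -[(false, i)]/(linv (true, i)) pushK //.
Qed.

Lemma gval_gens A : perm_eq (map snd (gval A)) (gens A).
Proof.
have inv u : perm_eq (map snd (ginv u)) (map snd u).
  by rewrite /ginv map_rev perm_rev -map_comp; apply/permP => a; congr count; apply: eq_map.
elim: A => //= [A IA B IB|B IB A IA|A IA B IB|i A IA|i A IA]; rewrite ?map_cat ?perm_cons //.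
- by apply: perm_cat => //; apply: perm_trans IA.
- by rewrite perm_catC; apply: perm_cat => //; apply: perm_trans IA.
- exact: perm_cat.
Qed.

Definition gnorm (A : itp) : nat := size (act (gval A) [::]).

Lemma size_gval A : size (gval A) = size (gens A).
Proof. by rewrite -(perm_size (gval_gens A)) size_map. Qed.

Lemma size_act u : size (act u [::]) <= size u.
Proof.
elim: u => //= x u; case: (act u [::]) => //= y w; case: ifP => _ /=; lia.
Qed.

Lemma gnorm_le A : gnorm A <= size (gens A).
Proof. by rewrite -size_gval size_act. Qed.

Lemma uniq_reduced u : uniq (map snd u) -> reduced u.
Proof.
elim: u => //= x [|y u] //= IH /andP[]; rewrite inE negb_or => /andP[ne _] /IH ->.
by rewrite andbT; apply: contra ne => /eqP ->.
Qed.

Lemma count_le1_uniq (s : seq nat) : (forall n, count_mem n s <= 1) -> uniq s.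
Proof.
elim: s => //= x s IH h; rewrite -has_pred1 has_count IH; last by move=> n; have := h n; lia.
by have := h x; rewrite eqxx; case: (count _ s).
Qed.

(** Cancellation needs two occurrences of the same index. *)
Lemma gnorm_uniq A : (forall n : nat, occ n A <= 1) -> gnorm A = size (gens A).
Proof.
move=> h; rewrite /gnorm act_nil ?size_gval //.
apply: uniq_reduced; rewrite (perm_uniq (gval_gens A)).
exact: count_le1_uniq.
Qed.

Definition bounded m (g : pred nat) (A : itp) : bool := (size (gens A) <= m) && all g (gens A).

Lemma all_word_gens (g : pred nat) As : all g (word_gens (map Ty As)) = all (fun A => all g (gens A)) As.
Proof. by elim: As => //= A As IH; rewrite word_gens_cons all_cat IH. Qed.

(** An index of the interpolant occurs in [K] and also outside [K].  As it occurs at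
    most twice in all, it occurs once on each side; so it occurs only once in the
    interpolant, and both new sequents are thin. *)
Lemma thin_cut g U K V C :
  thin (map Ty (U ++ K ++ V)) C -> der (map Ty (U ++ K ++ V)) C -> K <> [::] ->
  all (fun A => all g (gens A)) K ->
  exists E,
  [/\ der (map Ty K) E /\ der (map Ty (U ++ E :: V)) C,
      thin (map Ty K) E /\ thin (map Ty (U ++ E :: V)) C,
      gnorm E = size (gens E) & all g (gens E)].
Proof.
have bT As : bal (map Ty As) by elim: As.
rewrite !map_cat => t d nK aK.
have [||E [d1 d2 c1 c2]] := interpolation _ _ d; [exact: bT|by case: K nK {t d aK}|].
exists E; rewrite !map_cat /=.
split; [by []| |apply: gnorm_uniq|].
- split=> n; move: (t n) (c1 n) (c2 n); rewrite ?gensE; lia.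
- move=> n; move: (t n) (c1 n) (c2 n); rewrite ?gensE; lia.
- apply/allP => n nE; rewrite -all_word_gens in aK; apply: (allP aK).
  by rewrite -has_pred1 has_count; apply: leq_trans (c1 n); rewrite -has_count has_pred1.
Qed.

Lemma gprod_gval As u : gprod (rcons (map (fun A => act (gval A) [::]) As) (act u [::])) =
  act (gvalw (map Ty As)) (act u [::]).
Proof.
elim: As => [|A As IH] /=; first by rewrite act_nil // act_reduced.
by rewrite IH gvalw_cons act_cat act_act //.
Qed.

(** The values of the antecedent types and the inverse value of the succedent have
    product 1.  By [gprod_nil_split] two neighbours among them have a product of length
    at most [m], and this product, or its inverse, is the value of a suitable
    interpolant.  Cutting there leaves two shorter sequents with the same bound.
    [g] is any condition on indices; it is inherited because interpolants have no new
    indices. *)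
Lemma thin_binary m g (Q : seq itp -> itp -> Prop) :
  (forall As C, size As <= 2 -> der (map Ty As) C -> all (bounded m g) (C :: As) -> Q As C) ->
  (forall U K V E C, Q K E -> Q (U ++ E :: V) C -> Q (U ++ K ++ V) C) ->
  forall As C, thin (map Ty As) C -> der (map Ty As) C -> all (bounded m g) (C :: As) -> Q As C.
Proof.
move=> Qbase Qcut As; move: {2}(size As) (leqnn (size As)) => n.
elim: n As => [|n IH] As sA C t d b; first by apply: Qbase => //; lia.
have [s2|s2] := leqP (size As) 2; first exact: Qbase.
have bE E : gnorm E <= m -> gnorm E = size (gens E) -> all g (gens E) -> bounded m g E.
  by move=> h e gE; rewrite /bounded -e h.
have cut U K V : As = U ++ K ++ V -> 1 < size K -> size K < size As ->
    (forall E, der (map Ty K) E -> der (map Ty (U ++ E :: V)) C -> gnorm E <= m) -> Q As C.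
  move=> eAs sK sK' nE; rewrite eAs in t d b sA sK' *.
  move: b; rewrite /= !all_cat => /and4P[bC bU bK bV].
  have aK : all (fun A => all g (gens A)) K by apply: sub_all bK => A /andP[].
  have nK : K <> [::] by case: K sK {eAs t d sA sK' nE bK aK}.
  have [E [[d1 d2] [t1 t2] e gE]] := thin_cut t d nK aK.
  have bE' : bounded m g E by apply: bE (nE _ d1 d2) _ gE.
  move: sA sK'; rewrite !size_cat => sA sK'.
  apply: Qcut (IH _ _ _ t1 d1 _) (IH _ _ _ t2 d2 _).
  - by lia.
  - by rewrite /= bE' bK.
  - by rewrite size_cat /=; lia.
  - by rewrite /= bC all_cat bU /= bE' bV.
have nb A : bounded m g A -> gnorm A <= m by case/andP => h _; apply: leq_trans (gnorm_le A) h.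
pose nf A := act (gval A) [::].
have rnf A : reduced (nf A) by apply: act_reduced.
pose us := rcons (map nf As) (act (ginv (gval C)) [::]).
have Pus : gprod us = [::].
  by rewrite gprod_gval (der_act d) ?actVK // act_reduced.
have rus : all reduced us.
  by rewrite all_rcons act_reduced //=; elim: (As) => //= A As' ->; rewrite rnf.
have [a [x [y [c [eus sxy]]]]] : exists a x y c, us = a ++ x :: y :: c /\
    size (act x y) <= maxn (size x) (size y).
  move: rus Pus; rewrite /us; case: (As) s2 => [|A [|A' As']] //= _.
  exact: gprod_nil_split.
have bA A : A \in C :: As -> gnorm A <= m by move=> i; apply: nb; apply: (allP b).
case/lastP: c eus => [|c z] eus.
  (* The pair is the last type and the inverse of the succedent: interpolate all
     types but the last. *)
  have {}eus : us = rcons (rcons a x) y by rewrite eus -!cats1 -catA.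
  have [eus' ey] := rcons_inj eus.
  have [A1 [Xs [eAs _ eXs]]] : exists A1 Xs, [/\ As = A1 ++ Xs, map nf A1 = a & map nf Xs = [:: x]].
    by apply: map_eq_cat; rewrite eus' cats1.
  case: Xs eXs eAs => [|X [|? ?]] //= [ex] eAs.
  have sAs : size As = (size A1).+1 by rewrite eAs size_cat addn1.
  apply: (cut [::] A1 [:: X]) => //; try lia.
  move=> E _ d2; have := der_act d2 (act_reduced (ginv (gval X)) (isT : reduced [::])).
  rewrite /= gvalw_cons act_cat /= /gvalw /= cats0 actVK // /gnorm => ->.
  rewrite -act_cat -size_act_ginv ginv_cat ginvK act_cat.
  have -> : act (gval X) (act (ginv (gval C)) [::]) = act x y.
    by rewrite -ex -ey /nf act_act.
  apply: leq_trans sxy _; rewrite geq_max -ex -ey size_act_ginv /nf.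
  by rewrite !bA ?inE ?eqxx // eAs mem_cat inE eqxx !orbT.
have {}eus : us = rcons (a ++ x :: y :: c) z by rewrite eus rcons_cat.
have [eus' _] := rcons_inj eus.
have [A1 [Xs [eAs _ eXs]]] : exists A1 Xs,
    [/\ As = A1 ++ Xs, map nf A1 = a & map nf Xs = x :: y :: c] by apply: map_eq_cat.
case: Xs eXs eAs => [|X [|Y B1]] //= [ex ey _] eAs.
apply: (cut A1 [:: X; Y] B1) => // E d1 _.
have := der_act d1 (isT : reduced [::]).
rewrite /gvalw /= cats0 act_cat /gnorm => <-.
have -> : act (gval X) (act (gval Y) [::]) = act x y by rewrite -ex -ey /nf act_act.
apply: leq_trans sxy _; rewrite geq_max -ex -ey /nf.
by rewrite !bA // eAs !inE !mem_cat !inE eqxx !orbT.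
Qed.

(** * Hedges as words, and admissibility of cut *)

Fixpoint emb (A : tp) : itp :=
  match A with
  | prim i => Prim i
  | ldiv A B => Ldiv (emb A) (emb B)
  | rdiv B A => Rdiv (emb B) (emb A)
  | prod_tp A B => Prod (emb A) (emb B)
  | dia A => Dia 0 (emb A)
  | box A => Box 0 (emb A)
  end.

Fixpoint erase (A : itp) : tp :=
  match A with
  | Prim i => prim i
  | Ldiv A B => ldiv (erase A) (erase B)
  | Rdiv B A => rdiv (erase B) (erase A)
  | Prod A B => prod_tp (erase A) (erase B)
  | Dia _ A => dia (erase A)
  | Box _ A => box (erase A)
  end.

Lemma embK A : erase (emb A) = A.
Proof. by elim: A => //= [A -> B ->|B -> A ->|A -> B ->|A ->|A ->]. Qed.

Fixpoint tree_word (t : tree) : word :=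
  match t with
  | leaf A => [:: Ty (emb A)]
  | bracket G => Op 0 :: flatten (map tree_word G) ++ [:: Cl]
  end.

Definition hedge_word (G : hedge) : word := flatten (map tree_word G).

Lemma hedge_word_cat G H : hedge_word (G ++ H) = hedge_word G ++ hedge_word H.
Proof. by rewrite /hedge_word map_cat flatten_cat. Qed.

Lemma hedge_word_cons t H : hedge_word (t :: H) = tree_word t ++ hedge_word H.
Proof. by []. Qed.

Section TreeInd.
Variables (P : hedge -> Prop).
Hypothesis P0 : P [::].
Hypothesis Pleaf : forall A H, P H -> P (leaf A :: H).
Hypothesis Pbr : forall G H, P G -> P H -> P (bracket G :: H).

Fixpoint tree_cons_ind (t : tree) : forall H, P H -> P (t :: H) :=
  match t with
  | leaf A => fun H pH => Pleaf A pH
  | bracket G => fun H pH => Pbr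
      ((fix hind (G : hedge) : P G :=
        match G with [::] => P0 | t :: G' => @tree_cons_ind t G' (hind G') end) G) pH
  end.

(** Induction over the roots of a hedge and, at a bracket, also over its content. *)
Lemma hedge_ind H : P H.
Proof. by elim: H => // t H; apply: tree_cons_ind. Qed.
End TreeInd.

Lemma bal_hedge_word H : bal (hedge_word H).
Proof.
elim/hedge_ind: H => // G H bG bH.
exact: (bal_cat (bal_br 0 bG) bH).
Qed.

Definition good (W : word) : Prop := W <> [::] /\ bal W.

(** [W] may replace the members of [S] in every derivable sequent. *)
Definition closure (S : word -> Prop) (W : word) : Prop :=
  good W /\ forall U V C, (forall X, S X -> der (U ++ X ++ V) C) -> der (U ++ W ++ V) C.

(** A model whose truth values are closed sets of words.  Divisions and [Box]
    are interpreted by their right rules, which are invertible; [Prod] and [Dia] by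
    the closure of what their right rules produce. *)
Fixpoint sem (A : itp) : word -> Prop :=
  match A with
  | Prim i => fun W => der W (Prim i)
  | Ldiv A B => fun W => good W /\ forall X, sem A X -> sem B (X ++ W)
  | Rdiv B A => fun W => good W /\ forall X, sem A X -> sem B (W ++ X)
  | Prod A B => closure (fun W => exists X Y, [/\ W = X ++ Y, sem A X & sem B Y])
  | Dia i A => closure (fun W => exists2 X, W = Op i :: X ++ [:: Cl] & sem A X)
  | Box i A => fun W => good W /\ sem A (Op i :: W ++ [:: Cl])
  end.

Lemma der_good W A : der W A -> good W.
Proof. by move=> d; split; [apply: der_nonempty d|apply: der_bal d]. Qed.

Lemma sem_good A W : sem A W -> good W.
Proof. by case: A => [i|A B|B A|A B|i A|i A] /=; first exact: der_good; case. Qed.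

Lemma good_cat X Y : good X -> bal Y -> good (X ++ Y).
Proof. by move=> [nX bX] bY; split; [case: X nX {bX}|apply: bal_cat]. Qed.

Lemma good_cat' X Y : bal X -> good Y -> good (X ++ Y).
Proof. by move=> bX [nY bY]; split; [case: X {bX}|apply: bal_cat]. Qed.

Lemma good_br i X : bal X -> good (Op i :: X ++ [:: Cl]).
Proof. by move=> bX; split=> //; apply: bal_br. Qed.

Lemma good_context U X V : good X -> bal (U ++ X ++ V) -> good (U ++ X ++ V).
Proof. by move=> [nX _] b; split=> //; case: U {b} => //; case: X nX. Qed.

Lemma closure_idem S W : closure (closure S) W -> closure S W.
Proof. by move=> [gW h]; split=> // U V C hS; apply: h => X [_]; apply. Qed.

Lemma sem_closed A W : closure (sem A) W -> sem A W.
Proof.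
elim: A W => [i|A _ B IB|B IB A _|A _ B _|i A _|i A IA] W /=; try exact: closure_idem.
- by move=> [_ h]; move: (h [::] [::] (Prim i)); rewrite /= cats0; apply=> X; rewrite cats0.
- move=> [gW h]; split=> // X sX; apply: IB; split.
    by apply: good_cat'; first case: (sem_good sX).
  move=> U V C hB; have := h (U ++ X) V C; rewrite -!catA; apply=> Y [gY sY].
  by have := hB _ (sY _ sX); rewrite -!catA.
- move=> [gW h]; split=> // X sX; apply: IB; split.
    by apply: good_cat => //; case: (sem_good sX).
  move=> U V C hB; have := h U (X ++ V) C; rewrite -!catA; apply=> Y [gY sY].
  by have := hB _ (sY _ sX); rewrite -!catA.
- move=> [gW h]; split=> //; apply: IA; split; first by apply: good_br; case: gW.
  move=> U V C hA; have := h (U ++ [:: Op i]) (Cl :: V) C; rewrite -!catA /= -!catA /=.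
  by apply=> Y [gY sY]; have := hA _ sY; rewrite -!catA /= -!catA.
Qed.

Lemma closure_in_context S A U V W :
  closure S W -> good (U ++ W ++ V) -> (forall X, S X -> sem A (U ++ X ++ V)) -> sem A (U ++ W ++ V).
Proof.
move=> [gW h] g hS; apply: sem_closed; split=> // U' V' C hC.
have := h (U' ++ U) (V ++ V') C; rewrite -!catA; apply=> X /hS sX.
by have := hC _ sX; rewrite -!catA.
Qed.

(** The two halves need each other, because divisions are contravariant in their
    argument.  Together with soundness ([provable_sem]) they give cut elimination. *)
Lemma sem_Ty_der A : sem A [:: Ty A] /\ forall W, sem A W -> der W A.
Proof.
elim: A => [i|A [sA dA] B [sB dB]|B [sB dB] A [sA dA]|A [sA dA] B [sB dB]|i A [sA dA]|i A [sA dA]] /=.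
- by split=> //; apply: d_ax.
- split=> [|W [[nW _] h]]; last by apply: d_ldr => //; apply: dB; apply: (h [:: _]).
  split=> // X sX; apply: sem_closed; split; first by apply: good_cat' => //; case: (sem_good sX).
  move=> U V C hB; rewrite -catA; apply: d_ldl (dA _ sX) _; exact: (hB [:: Ty B]).
- split=> [|W [[nW _] h]]; last by apply: d_rdr => //; apply: dB; apply: h.
  split=> // X sX; apply: sem_closed; split; first by apply: (@good_cat [:: _]) => //; case: (sem_good sX).
  move=> U V C hB; exact: d_rdl (dA _ sX) (hB [:: Ty B] sB).
- split=> [|W [gW h]].
    split=> // U V C h; apply: d_prl; apply: (h [:: _; _]); by exists [:: Ty A], [:: Ty B].
  have := h [::] [::] (Prod A B); rewrite /= cats0; apply=> X [Y [Z [-> sY sZ]]].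
  by rewrite cats0; apply: d_prr; [apply: dA|apply: dB].
- split=> [|W [gW h]].
    split=> // U V C h; apply: d_dil; apply: (h [:: _; _; _]); by exists [:: Ty A].
  have := h [::] [::] (Dia i A); rewrite /= cats0; apply=> X [Y -> sY].
  by rewrite cats0; apply: d_dir; apply: dA.
- split=> [|W [[nW bW] h]]; last by apply: d_bor => //; apply: dA.
  split=> //; apply: sem_closed; split=> // U V C h; apply: d_bol; exact: (h [:: _]).
Qed.

(** The words obtained from a hedge by putting, for each leaf, a word from the
    interpretation of its type. *)
Inductive inst : hedge -> word -> Prop :=
| inst_nil : inst [::] [::]
| inst_leaf A X H W : sem (emb A) X -> inst H W -> inst (leaf A :: H) (X ++ W)
| inst_bracket G X H W :
    inst G X -> inst H W -> inst (bracket G :: H) (Op 0 :: X ++ Cl :: W).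

Lemma inst_bal H W : inst H W -> bal W.
Proof.
elim=> // {H W} [A X H W /sem_good[_ bX] _ bW|G X H W _ bX _ bW]; first exact: bal_cat.
by have := bal_cat (bal_br 0 bX) bW; rewrite /= -catA.
Qed.

Lemma inst_cat G H X Y : inst G X -> inst H Y -> inst (G ++ H) (X ++ Y).
Proof.
move=> iG iH; elim: iG => //= {G X} [A X G W sA _ IH|G X G' W iG _ _ IH].
  by rewrite -catA; apply: inst_leaf.
by rewrite -catA /=; apply: inst_bracket.
Qed.

Lemma inst_catE G H W : inst (G ++ H) W -> exists X Y, [/\ W = X ++ Y, inst G X & inst H Y].
Proof.
elim: G W => [|t G IH] W /= i; first by exists [::], W; split=> //; apply: inst_nil.
inversion i as [|A X H' W' sA iH|G' X H' W' iG iH]; subst.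
- have [X' [Y [-> i1 i2]]] := IH _ iH; exists (X ++ X'), Y; rewrite catA; split=> //.
  exact: inst_leaf.
- have [X' [Y [-> i1 i2]]] := IH _ iH; exists (Op 0 :: X ++ Cl :: X'), Y; rewrite /= -catA.
  by split=> //; apply: inst_bracket.
Qed.

Lemma inst1 A X : sem (emb A) X -> inst [:: leaf A] X.
Proof. by move=> sX; rewrite -[X]cats0; apply: inst_leaf => //; apply: inst_nil. Qed.

Lemma inst1E A X : inst [:: leaf A] X -> sem (emb A) X.
Proof.
move=> i; inversion i as [|A' X' H' W' sA iH|]; subst.
by inversion iH; rewrite cats0.
Qed.

Lemma inst_br G X : inst G X -> inst [:: bracket G] (Op 0 :: X ++ [:: Cl]).
Proof. by move=> iG; apply: inst_bracket iG inst_nil. Qed.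

Lemma inst_brE G W : inst [:: bracket G] W -> exists2 X, W = Op 0 :: X ++ [:: Cl] & inst G X.
Proof.
by move=> i; inversion i as [| |G' X' H' W' iG iH]; subst; inversion iH; exists X'.
Qed.

Lemma inst_fill C H W : inst (fill C H) W -> exists U X V,
  [/\ W = U ++ X ++ V, inst H X
    & forall H' X', inst H' X' -> inst (fill C H') (U ++ X' ++ V)].
Proof.
elim: C W => [L R|L C IH R] W /= /inst_catE[U [Y [-> iL iY]]].
- have [X [V [-> iX iV]]] := inst_catE iY; exists U, X, V; split=> // H' X' i.
  by apply: inst_cat => //; apply: inst_cat.
- have [Y' [V [-> /inst_brE[Z -> iZ] iV]]] := inst_catE (iY : inst ([:: _] ++ R) Y).
  have [U' [X [V' [-> iX h]]]] := IH _ iZ.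
  exists (U ++ Op 0 :: U'), X, (V' ++ Cl :: V); split=> //; first by rewrite -?catA /= -?catA.
  move=> H' X' /h i; have := inst_cat iL (inst_bracket i iV); by rewrite -?catA /= -?catA.
Qed.

Lemma inst_hedge_word H : inst H (hedge_word H).
Proof.
elim/hedge_ind: H => [|A H i|G H iG iH]; first exact: inst_nil.
- by apply: (@inst_leaf _ [:: _]) => //; case: (sem_Ty_der (emb A)).
- by rewrite hedge_word_cons /= -catA; apply: inst_bracket.
Qed.

Lemma inst_nonempty H W : inst H W -> H <> [::] -> W <> [::].
Proof. by case=> // A X H' W' /sem_good[nX _] _ _; case: X nX. Qed.

(** Otherwise [bracket_splitP] would make the empty word derivable. *)
Lemma der_no_empty_bracket i U V C : ~ der (U ++ Op i :: Cl :: V) C.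
Proof.
have cT : subtype_closed predT by case.
have aT W : all (ty_in predT) W by elim: W => // -[].
move=> /(@bracket_splitP predT i U [::] V C cT bal_nil)/(_ (aT _) isT).
by case=> F [] [_ /der_nonempty].
Qed.

(** Soundness of the calculus of hedges in the model; cut is transitivity of
    inclusion. *)
Lemma provable_sem H A : provable H A -> forall W, inst H W -> sem (emb A) W.
Proof.
elim=> {H A} /=.
- by move=> i W; apply: inst1E.
- move=> G D A B C _ IG _ IC W /inst_fill[U [X [V [-> /inst_catE[X1 [X2 [-> i1 /inst1E[_ s2]]]] h]]]].
  by apply: IC; apply: h; apply: inst1; apply: s2; apply: IG.
- move=> P A B nP _ IB W iW; split.
    split; last exact: inst_bal iW.
    exact: inst_nonempty iW nP.
  by move=> X sX; apply: IB; apply: inst_leaf.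
- move=> G D A B C _ IG _ IC W /inst_fill[U [X [V [-> /(@inst_catE [:: _])[X1 [X2 [-> /inst1E[_ s1] i2]]] h]]]].
  by apply: IC; apply: h; apply: inst1; apply: s1; apply: IG.
- move=> P A B nP _ IB W iW; split.
    split; last exact: inst_bal iW.
    exact: inst_nonempty iW nP.
  by move=> X sX; apply: IB; apply: inst_cat => //; apply: inst1.
- move=> D A B C _ IC W iW; have bW := inst_bal iW; have [U [X [V [eW /inst1E cX h]]]] := inst_fill iW.
  subst W; apply: (closure_in_context cX); first exact: good_context cX.1 bW.
  by move=> Z [Y1 [Y2 [-> s1 s2]]]; apply: IC; apply: h; apply: (@inst_cat [:: _]); apply: inst1.
- move=> G D A B _ IG _ ID W /inst_catE[X [Y [-> /IG sX /ID sY]]].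
  split; first by apply: good_cat (sem_good sX) _; case: (sem_good sY).
  by move=> U V C; apply; exists X, Y.
- move=> D A C _ IC W iW; have bW := inst_bal iW; have [U [X [V [eW /inst1E cX h]]]] := inst_fill iW.
  subst W; apply: (closure_in_context cX); first exact: good_context cX.1 bW.
  by move=> Z [Y -> s]; apply: IC; apply: h; apply: inst_br; apply: inst1.
- move=> G A _ IG W /inst_brE[X -> /IG sX]; split; first by apply: good_br; case: (sem_good sX).
  by move=> U V C; apply; exists X.
- move=> D A C _ IC W /inst_fill[U [X [V [-> /inst_brE[Y -> /inst1E[_ sA]] h]]]].
  by apply: IC; apply: h; apply: inst1.
- move=> G A _ IG W iW; have sA := IG _ (inst_br iW); split=> //; split; last exact: inst_bal iW.
  (* An empty [W] would come from a derivable empty bracket. *)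
  by move=> e; rewrite e in sA; apply: (@der_no_empty_bracket 0 [::] [::] _ ((sem_Ty_der _).2 _ sA)).
- move=> G D A C _ IG _ IC W /inst_fill[U [X [V [-> /IG sX h]]]].
  by apply: IC; apply: h; apply: inst1.
Qed.

Lemma provable_der H A : provable H A -> der (hedge_word H) (emb A).
Proof. by move=> p; apply: (sem_Ty_der _).2; apply: provable_sem p _ (inst_hedge_word H). Qed.

(** * From words back to hedges *)

(** Hedges have no indices on their brackets, so words are compared with them after
    every modality has been given the index 0. *)
Definition unlabel (s : sym) : sym :=
  match s with Op _ => Op 0 | Cl => Cl | Ty A => Ty (emb (erase A)) end.

Lemma run_unlabel n W : run n (map unlabel W) = run n W.
Proof. by elim: W n => [|[i||A] W IH] [|n] //=. Qed.

Fixpoint pre (C : context) : word :=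
  match C with
  | hole L _ => hedge_word L
  | inside L C _ => hedge_word L ++ Op 0 :: pre C
  end.

Fixpoint post (C : context) : word :=
  match C with
  | hole _ R => hedge_word R
  | inside _ C R => post C ++ Cl :: hedge_word R
  end.

Lemma hedge_word_fill C H : hedge_word (fill C H) = pre C ++ hedge_word H ++ post C.
Proof.
elim: C => [L R|L C IH R] /=; first by rewrite !hedge_word_cat.
rewrite hedge_word_cat hedge_word_cons /= -/(hedge_word _) IH -?catA /= -?catA; by [].
Qed.

Lemma context_cons t C : exists C', [/\ pre C' = tree_word t ++ pre C, post C' = post C
  & forall K, fill C' K = t :: fill C K].
Proof.
case: C => [L R|L C R]; [exists (hole (t :: L) R)|exists (inside (t :: L) C R)];
by split=> //=; rewrite hedge_word_cons -?catA.
Qed.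

Lemma leaf_context H U X V : hedge_word H = U ++ Ty X :: V ->
  exists C B, [/\ X = emb B, H = fill C [:: leaf B], pre C = U & post C = V].
Proof.
elim/hedge_ind: H U V => [|A H IH|G H IG IH] U V; first by case: U.
- case: U => [|y U] [ey eH].
    by exists (hole [::] H), A; rewrite -ey -eH.
  have [C [B [-> -> <- <-]]] := IH _ _ eH; rewrite -ey.
  by have [C' [eU eV eK]] := context_cons (leaf A) C; exists C', B; rewrite eU eV eK.
- rewrite hedge_word_cons /= -/(hedge_word G) -catA; case: U => [//|y U] [<- eH].
  case: (@cat_split_cons _ (hedge_word G) ([:: Cl] ++ hedge_word H) U V (Ty X) eH) => [[V' [eG ->]]|[U' [-> e]]].
    have [C [B [-> -> <- <-]]] := IG _ _ eG.
    by exists (inside [::] C H), B.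
  case: U' e => [//|z U'] [<- e]; have [C [B [-> -> <- <-]]] := IH _ _ e.
  have [C' [eU eV eK]] := context_cons (bracket G) C; exists C', B; rewrite eU eV eK.
  by rewrite /= -/(hedge_word G) -catA.
Qed.

Lemma hedge_word_Cl H W : hedge_word H <> Cl :: W.
Proof. by case: H => [|[]]. Qed.

Lemma hedge_word_Op H W i : hedge_word H <> rcons W (Op i).
Proof.
move=> e; have := bal_hedge_word H; rewrite e -cats1 /bal run_cat.
by case: (run 0 W).
Qed.

Lemma hedge_word_eq0 H : hedge_word H = [::] -> H = [::].
Proof. by case: H => [|[]]. Qed.

Lemma context_next_leaf C X V : post C = Ty X :: V ->
  exists B C', [/\ X = emb B, pre C' = pre C, post C' = V
    & forall K, fill C K = fill C' (K ++ [:: leaf B])].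
Proof.
elim: C V => [L R|L C IH R] V /=.
  case: R => [|[B|G] R] //= [<- <-]; exists B, (hole L R); split=> // K /=.
  by rewrite -catA.
case E: (post C) => [|s V'] //= [es eV]; rewrite es in E.
have [B [C' [eX ep eq ef]]] := IH _ E; exists B, (inside L C' R); split=> //=.
- by rewrite ep.
- by rewrite eq.
- by move=> K; rewrite ef.
Qed.

(** A hole between [Op 0] and [Cl] is alone in its bracket, and the bracket can be
    moved into the filling. *)
Lemma context_in_bracket C U V : pre C = rcons U (Op 0) -> post C = Cl :: V ->
  exists C', [/\ pre C' = U, post C' = V & forall K, fill C K = fill C' [:: bracket K]].
Proof.
elim: C U V => [L R|L C IH R] U V /=; first by move=> _ /hedge_word_Cl.
case/lastP E: (pre C) => [|U' x]; last first.
  rewrite -rcons_cons -rcons_cat => /rcons_inj[<- ex]; rewrite ex in E.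
  case E' : (post C) => [|y V'].
    by case: C E E' {IH} => [L' R' /= e|L' C' R' /= _ e]; [case: (hedge_word_Op e)|case: (cat_neq_nil e)].
  case=> ey <-; rewrite ey in E'; have [C' [<- <- eK]] := IH _ _ E E'.
  by exists (inside L C' R); split=> // K /=; rewrite eK.
rewrite cats1 => /rcons_inj[<-].
case: C E {IH} => [L' R' /= /hedge_word_eq0 -> | L' C' R' /= e]; last by case: (cat_neq_nil e).
case E' : (hedge_word R') => [|y V'] /=; last by case=> ey; case: (@hedge_word_Cl R' V'); rewrite E' ey.
by rewrite (hedge_word_eq0 E') => -[<-]; exists (hole L R); split=> // K /=; rewrite cats0.
Qed.

Lemma emb_inj : injective emb.
Proof. exact: can_inj embK. Qed.

Definition provable_word (W : word) (A : itp) : Prop :=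
  exists2 H, hedge_word H = map unlabel W & provable H (erase A).

(** The rules of [der] become rules on hedges once the position of the active types
    in the word is read as a context of the hedge. *)
Lemma der_provable W A : der W A -> provable_word W A.
Proof.
elim=> {W A}.
- by move=> p; exists [:: leaf (prim p)] => //; apply: ax.
- move=> G U V A B C _ [HG eG pG] _ [H eH pH]; rewrite map_cat /= in eH.
  have [D [B' [/emb_inj <- eD eU eV]]] := leaf_context eH; rewrite eD in pH.
  exists (fill D (HG ++ [:: leaf (ldiv (erase A) (erase B))])); last exact: ldiv_l.
  by rewrite hedge_word_fill hedge_word_cat eG eU eV !map_cat /= -catA.
- move=> W A B nW _ [[|[A'|?] H] //= [eA eH] pH].
  exists H => //; apply: ldiv_r; first by move=> e; move: nW eH; rewrite e; case: (W).
  by rewrite (emb_inj eA) in pH.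
- move=> G U V A B C _ [HG eG pG] _ [H eH pH]; rewrite map_cat /= in eH.
  have [D [B' [/emb_inj <- eD eU eV]]] := leaf_context eH; rewrite eD in pH.
  exists (fill D ([:: leaf (rdiv (erase B) (erase A))] ++ HG)); last exact: rdiv_l.
  by rewrite hedge_word_fill hedge_word_cat eG eU eV !(map_cat, map_cons).
- move=> W A B nW _ [H eH pH]; rewrite map_cat /= in eH.
  case/lastP: H eH pH => [|H [A'|G]]; first by case: (W).
    rewrite -cats1 hedge_word_cat /= !cats1 => /rcons_inj[eH [/emb_inj ->]] pH.
    exists H => //; apply: rdiv_r; last by rewrite cats1.
    by move=> e; move: nW eH; rewrite e; case: (W).
  move=> /(congr1 (last Cl)); rewrite -cats1 hedge_word_cat hedge_word_cons /= cats0.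
  by rewrite !last_cat /= last_cat.
- move=> U V A B C _ [H eH pH]; rewrite map_cat /= in eH.
  have [D [A' [/emb_inj <- eD eU eV]]] := leaf_context eH; rewrite eD in pH.
  have [B' [D' [/emb_inj <- eU' eV' eK]]] := context_next_leaf eV; rewrite eK in pH.
  exists (fill D' [:: leaf (prod_tp (erase A) (erase B))]); last exact: prod_l.
  by rewrite hedge_word_fill eU' eV' eU map_cat.
- move=> G D A B _ [HG eG pG] _ [HD eD pD]; exists (HG ++ HD); last exact: prod_r.
  by rewrite hedge_word_cat eG eD map_cat.
- move=> U V i A C _ [H eH pH]; rewrite map_cat /= -cat_rcons in eH.
  have [D [A' [/emb_inj <- eD eU eV]]] := leaf_context eH; rewrite eD in pH.
  have [D' [eU' eV' eK]] := context_in_bracket eU eV; rewrite eK in pH.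
  exists (fill D' [:: leaf (dia (erase A))]); last exact: dia_l.
  by rewrite hedge_word_fill eU' eV' map_cat.
- move=> G i A _ [H eH pH]; exists [:: bracket H]; last exact: dia_r.
  by rewrite hedge_word_cons /= -/(hedge_word H) eH cats0 map_cat.
- move=> U V i A C _ [H eH pH]; rewrite map_cat /= in eH.
  have [D [A' [/emb_inj <- eD eU eV]]] := leaf_context eH; rewrite eD in pH.
  exists (fill D [:: bracket [:: leaf (box (erase A))]]); last exact: box_l.
  by rewrite hedge_word_fill eU eV map_cat.
- move=> W i A nW bW _ [H eH pH]; rewrite /= map_cat /= in eH.
  case: H eH pH => [|[B|G] H] //=; rewrite hedge_word_cons /= -/(hedge_word G) -catA /= => -[eH] pH.
  have bW' : bal (map unlabel W) by rewrite /bal run_unlabel.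
  have [eG e0] := bal_cons_Cl_inj (bal_hedge_word G) bW' eH.
  by rewrite (hedge_word_eq0 e0) in pH; exists G => //; apply: box_r.
Qed.

(** * The context-free grammar *)

Lemma hedge_word_flat H As : hedge_word H = map (fun A => Ty (emb A)) As -> H = map leaf As.
Proof.
elim: As H => [|A As IH] [|[B|G] H] //= [/emb_inj -> /IH ->]; by [].
Qed.

Lemma der_provable_flat As C : der (map Ty As) C -> provable (map (fun A => leaf (erase A)) As) (erase C).
Proof.
case/der_provable => H eH; suff -> : H = map leaf (map erase As) by rewrite -map_comp.
by apply: hedge_word_flat; rewrite eH -!map_comp.
Qed.

(** The [Cl] found here closes the innermost of the [n.+1] open brackets. *)
Lemma bal_close n W k : run n.+1 W = Some k -> k <= n ->
  exists X V, W = X ++ Cl :: V /\ bal X.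
Proof.
move: {2}(size W) (leqnn (size W)) => s.
elim: s W n => [|s IH] [|[i||A] W] n //=; try by move=> _ [<-]; rewrite ltnn.
- rewrite ltnS => sW hW kn.
  have [X [V [eW bX]]] := IH _ _ sW hW (leqW kn); subst W.
  rewrite run_bal_cat //= in hW; rewrite size_cat /= in sW.
  have [|X' [V' [eV bX']]] := IH V n _ hW kn; first by lia.
  exists (Op i :: X ++ Cl :: X'), V'; rewrite eV /= -catA; split=> //.
  by have := bal_cat (bal_br i bX) bX'; rewrite /= -catA.
- by move=> sW hW kn; exists [::], W.
- rewrite ltnS => sW hW kn; have [X [V [-> bX]]] := IH _ _ sW hW kn.
  by exists (Ty A :: X), V.
Qed.

Lemma flat_or_bracket W : bal W -> (exists As, W = map Ty As) \/
  exists U i X V, W = U ++ Op i :: X ++ Cl :: V /\ bal X.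
Proof.
elim: W => [|[i||A] W IH]; first by left; exists [::].
- by rewrite /bal /= => /bal_close[//|X [V [-> bX]]]; right; exists [::], i, X, V.
- by [].
- move=> /IH[[As ->]|[U [i [X [V [-> bX]]]]]]; first by left; exists (A :: As).
  by right; exists (Ty A :: U), i, X, V.
Qed.

Lemma size_gens_gt0 A : 0 < size (gens A).
Proof. by elim: A => //= *; rewrite size_cat; lia. Qed.

Definition next_types (I : seq nat) (T : seq itp) : seq itp :=
  [seq Prim i | i <- I] ++ [seq Ldiv A B | A <- T, B <- T] ++
  [seq Rdiv B A | B <- T, A <- T] ++ [seq Prod A B | A <- T, B <- T] ++
  [seq Dia i A | i <- I, A <- T] ++ [seq Box i A | i <- I, A <- T].

(** The types of height at most [k] with indices at most [M]. *)
Definition types_upto (M k : nat) : seq itp := iter k (next_types (iota 0 M.+1)) [::].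

(** The height of a type is at most its number of indices: a modality adds one
    index, and both arguments of a binary connective have at least one. *)
Lemma bounded_types M k A : bounded k (leq^~ M) A -> A \in types_upto M k.
Proof.
have I i : i <= M -> i \in iota 0 M.+1 by rewrite mem_iota.
elim: k A => [|k IH] A; first by rewrite /bounded leqNgt size_gens_gt0.
have h B : size (gens B) <= k -> all (leq^~ M) (gens B) -> B \in types_upto M k.
  by move=> s a; apply: IH; rewrite /bounded s.
rewrite /types_upto iterS -/(types_upto M k) /bounded.
move: (types_upto M k) (iota 0 M.+1) h I {IH} => T J h I; rewrite /next_types !mem_cat => /andP[].
case: A => [i|A B|B A|A B|i A|i A] /=; rewrite ?size_cat ?all_cat => s.
- rewrite andbT => /I iM; by rewrite (map_f Prim iM).
- move=> /andP[a1 a2]; have gA := size_gens_gt0 A; have gB := size_gens_gt0 B.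
  by rewrite (allpairs_f Ldiv (h A _ a1) (h B _ a2)) ?orbT //; lia.
- move=> /andP[a1 a2]; have gA := size_gens_gt0 A; have gB := size_gens_gt0 B.
  by rewrite (allpairs_f Rdiv (h B _ a2) (h A _ a1)) ?orbT //; lia.
- move=> /andP[a1 a2]; have gA := size_gens_gt0 A; have gB := size_gens_gt0 B.
  by rewrite (allpairs_f Prod (h A _ a1) (h B _ a2)) ?orbT //; lia.
- by move=> /andP[/I iM a]; rewrite (allpairs_f Dia iM (h A _ a)) ?orbT.
- by move=> /andP[/I iM a]; rewrite (allpairs_f Box iM (h A _ a)) ?orbT.
Qed.

Fixpoint subtypes (A : itp) : seq itp :=
  A :: match A with
       | Prim _ => [::]
       | Ldiv A B | Rdiv B A => subtypes A ++ subtypes B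
       | Prod A B => subtypes A ++ subtypes B
       | Dia _ A | Box _ A => subtypes A
       end.

Lemma subtypes_refl A : A \in subtypes A.
Proof. by case: A => *; rewrite inE eqxx. Qed.

Lemma subtypes_trans A B : A \in subtypes B -> {subset subtypes A <= subtypes B}.
Proof.
elim: B => [i|B IB C IC|C IC B IB|B IB C IC|i B IB|i B IB] /=;
  first (by rewrite inE => /eqP ->); rewrite inE => /predU1P[-> //|]; rewrite ?mem_cat.
- by case/orP => [/IB|/IC] s X /s; rewrite inE mem_cat => ->; rewrite ?orbT.
- by case/orP => [/IB|/IC] s X /s; rewrite inE mem_cat => ->; rewrite ?orbT.
- by case/orP => [/IB|/IC] s X /s; rewrite inE mem_cat => ->; rewrite ?orbT.
- by move/IB => s X /s; rewrite inE => ->; rewrite orbT.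
- by move/IB => s X /s; rewrite inE => ->; rewrite orbT.
Qed.

Lemma subtypes_closed s : subtype_closed (mem (flatten (map subtypes s))).
Proof.
move=> A /flatten_mapP[B sB AB].
have h X : X \in subtypes A -> X \in flatten (map subtypes s).
  by move=> XA; apply/flatten_mapP; exists B => //; apply: subtypes_trans AB _ XA.
by case: A {AB} h => //= [A C|C A|A C|i A|i A] h; rewrite -?topredE /=; try split; apply: h;
  rewrite inE ?mem_cat subtypes_refl ?orbT.
Qed.

(** Excluded middle takes the place of a decision procedure for [P]. *)
Lemma classical_filter (T : eqType) (P : T -> Prop) (s : seq T) :
  exists s' : seq T, forall x, x \in s' <-> x \in s /\ P x.
Proof.
elim: s => [|y s [s' h]]; first by exists [::] => x; split=> // -[].
case: (classic (P y)) => Py; [exists (y :: s')|exists s'] => x; rewrite !inE.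
- split; first by case/predU1P => [->|/h[-> ?]]; rewrite ?eqxx ?orbT.
  by case=> /predU1P[-> //|xs Px]; rewrite ?eqxx //; apply/orP; right; apply/h.
- rewrite h; split; first by case=> -> ?; rewrite orbT.
  by case=> /predU1P[->|].
Qed.

Section Grammar.
Variables (Sigma : finType) (lex : seq (Sigma * tp)).

Definition lang (A : itp) (w : seq Sigma) : Prop :=
  exists2 H, provable H (erase A) & all2 (fun a B => (a, B) \in lex) w (yield H).

Lemma yield_cat G H : yield (G ++ H) = yield G ++ yield H.
Proof. by rewrite /yield map_cat flatten_cat. Qed.

Lemma all2_cat (S T : Type) (r : S -> T -> bool) s1 s2 t1 t2 :
  all2 r s1 t1 -> all2 r s2 t2 -> all2 r (s1 ++ s2) (t1 ++ t2).
Proof. by elim: s1 t1 => [|x s1 IH] [|y t1] //= /andP[-> /IH]. Qed.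

Lemma lang_unit A B w : der [:: Ty B] A -> lang B w -> lang A w.
Proof.
move=> /(@der_provable_flat [:: B]) d [H pH aH]; exists H => //.
by have := cut (D := hole [::] [::]) pH d; rewrite /= cats0.
Qed.

Lemma lang_binary A B C u v : der [:: Ty B; Ty C] A -> lang B u -> lang C v -> lang A (u ++ v).
Proof.
move=> /(@der_provable_flat [:: B; C]) d [H pH aH] [G pG aG].
exists (H ++ G); last by rewrite yield_cat; apply: all2_cat.
have d' := cut (D := hole [::] [:: leaf (erase C)]) pH d.
by have := cut (D := hole H [::]) pG d'; rewrite /= cats0.
Qed.

Lemma lang_lex A a : (a, erase A) \in lex -> lang A [:: a].
Proof.
move=> aA; exists [:: leaf (erase A)]; last by rewrite /= aA.
exact: (@der_provable_flat [:: A] _ (der_id A)).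
Qed.

Lemma lang_dia i A w : lang A w -> lang (Dia i A) w.
Proof.
move=> [H pH aH]; exists [:: bracket H]; first exact: dia_r.
by rewrite /yield /= cats0.
Qed.

(** <H> has the yield of [H], and derives [A] when [H] derives [box A]. *)
Lemma lang_box i A w : lang (Box i A) w -> lang A w.
Proof.
move=> [H pH aH]; exists [:: bracket H]; last by rewrite /yield /= cats0.
have d := @der_provable_flat [:: A] _ (der_id A).
have d' := @box_l (hole [::] [::]) _ _ d.
by have := cut (D := inside [::] (hole [::] [::]) [::]) pH d'; rewrite /= cats0.
Qed.

Variables (N : seq itp).

Notation nonterm := 'I_(size N).+1.
Notation form := (seq (nonterm + Sigma)).

(** Meaningful for members of [N] only: other types get the index [size N]. *)
Definition nt (A : itp) : nonterm := inord (index A N).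
Definition ty_of (X : nonterm) : itp := nth (Prim 0) N X.

Lemma ntK A : A \in N -> ty_of (nt A) = A.
Proof.
move=> AN; rewrite /ty_of inordK ?nth_index //.
by rewrite ltnS index_size.
Qed.

(** The words that a sentential form stands for if each nonterminal generates its
    language. *)
Fixpoint matches (s : form) (w : seq Sigma) : Prop :=
  match s with
  | [::] => w = [::]
  | x :: s' => exists u v, [/\ w = u ++ v,
      match x with inl X => lang (ty_of X) u | inr a => u = [:: a] end & matches s' v]
  end.

Lemma matches_cat s t w :
  matches (s ++ t) w <-> exists u v, [/\ w = u ++ v, matches s u & matches t v].
Proof.
elim: s w => [|x s IH] w /=.
  by split=> [h|[u [v [-> -> //]]]]; exists [::], w.
split=> [[u [v [-> hx /IH[u' [v' [-> h1 h2]]]]]]|[u [v [-> [u1 [u2 [-> hx h1]]] h2]]]].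
  by exists (u ++ u'), v'; rewrite catA; split=> //; exists u, u'.
by exists u1, (u2 ++ v); rewrite catA; split=> //; apply/IH; exists u2, v.
Qed.

Lemma matches_letters w : matches (map inr w) w.
Proof. by elim: w => //= a w IH; exists [:: a], w. Qed.

Definition sound_rule (r : nonterm * form) : Prop :=
  forall w, matches r.2 w -> lang (ty_of r.1) w.

(** Taking every sound rule of length at most two makes the soundness of the grammar
    immediate and leaves only the choice of useful rules to the completeness proof. *)
Lemma cfg_of_sound_rules : exists R : seq (nonterm * form), forall r,
  r \in R <-> size r.2 <= 2 /\ sound_rule r.
Proof.
pose E : seq (nonterm + Sigma) := enum {: nonterm + Sigma}.
pose short : seq form := [::] :: [seq [:: x] | x <- E] ++ [seq [:: x; y] | x <- E, y <- E].
have [R hR] := classical_filter sound_rule [seq (X, s) | X <- enum 'I_(size N).+1, s <- short].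
exists R => r; rewrite hR; split=> -[h sr]; split=> //.
  case/allpairsP: h => -[X s] [_ /= hs ->] /=.
  move: hs; rewrite inE mem_cat => /or3P[/eqP -> //|/mapP[x _ ->] //|/allpairsP[p [_ _ ->]] //].
case: r h {sr} => X s; rewrite [X in X <= _]/= => ss; apply/allpairsPdep; exists X, s; split=> //=; first by rewrite mem_enum.
have inE' x : x \in E by rewrite mem_enum.
rewrite inE mem_cat; case: s ss => [|x [|y [|? ?]]] // _.
- by apply/orP; right; apply/orP; left; apply: map_f.
- by apply/orP; right; apply/orP; right; apply/allpairsPdep; exists x, y.
Qed.
End Grammar.

Section Derivations.
Variables (Sigma : finType) (G : cfg Sigma).

Definition derives (s t : seq (nonterminal G + Sigma)) : Prop :=
  clos_refl_trans _ (@cfg_step Sigma G) s t.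

Lemma derives_trans s t u : derives s t -> derives t u -> derives s u.
Proof. exact: rt_trans. Qed.

Lemma derives_context u v s t : derives s t -> derives (u ++ s ++ v) (u ++ t ++ v).
Proof.
elim=> {s t} [_ _ [u' v' X alpha r]|s|s t s' _ IH _ IH'].
- apply: rt_step; have := CFGStep (u ++ u') (v' ++ v) r; by rewrite -!catA.
- exact: rt_refl.
- exact: derives_trans IH IH'.
Qed.

Lemma derives_rule X alpha : (X, alpha) \in rules G -> derives [:: inl X] alpha.
Proof. by move=> r; apply: rt_step; have := CFGStep [::] [::] r; rewrite /= cats0. Qed.

Lemma derives_replace s u t v w : derives s (u ++ t ++ v) -> derives t w -> derives s (u ++ w ++ v).
Proof. by move=> d1 d2; apply: derives_trans d1 _; apply: derives_context. Qed.
End Derivations.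

Section Completeness.
Variables (Sigma : finType) (lex : seq (Sigma * tp)) (m M : nat) (P : pred itp) (D : itp).
Hypotheses (cP : subtype_closed P) (bP : forall A, P A -> bounded m (leq^~ M) A).
Let N := types_upto M m.
Variables (R : seq ('I_(size N).+1 * seq ('I_(size N).+1 + Sigma))).
Hypothesis RP : forall r, r \in R <-> size r.2 <= 2 /\ sound_rule lex r.
Let G : cfg Sigma := CFG (nt N D) R.

Definition nts (As : seq itp) : seq (nonterminal G + Sigma) := [seq inl (nt N A) | A <- As].

Lemma bounded_N A : bounded m (leq^~ M) A -> A \in N.
Proof. exact: bounded_types. Qed.

Lemma P_N A : P A -> A \in N.
Proof. by move/bP/bounded_N. Qed.

Lemma derives_sequent As C : size As <= 2 -> der (map Ty As) C ->
  all (bounded m (leq^~ M)) (C :: As) -> derives (nts [:: C]) (nts As).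
Proof.
move=> sA d /andP[/bounded_N nC bA]; apply: derives_rule; apply/RP; split; first by rewrite size_map.
move=> w /=; rewrite ntK // {nC}.
case: As d bA sA => [|A [|B [|? ?]]] d //= + _; first by case: (der_nonempty d).
- rewrite andbT => /bounded_N nA [u [v [-> + ->]]]; rewrite ntK // cats0; exact: lang_unit.
- move=> /and3P[/bounded_N nA /bounded_N nB _] [u [_ [-> + [v [v' [-> + ->]]]]]].
  rewrite !ntK // cats0; exact: lang_binary.
Qed.

(** A thin version of the sequent is decomposed into sequents with at most two types.
    Relabelling back turns these into rules and the cuts into steps of the derivation. *)
Lemma derives_flat As C : der (map Ty As) C -> all (bounded m (leq^~ M)) (C :: As) ->
  derives (nts [:: C]) (nts As).
Proof.
move=> d b; have [f [W' [C' [d' t eW eC]]]] := thin_exists d.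
have [As' [eW' eAs]] : exists As', W' = map Ty As' /\ map (relabel f) As' = As.
  elim: As W' eW {d b d' t} => [|A As IH] [|[i||A'] W'] //=; first by exists [::].
  by case=> <- /IH[As' [-> <-]]; exists (A' :: As').
have bR A : bounded m (fun n => f n <= M) A -> bounded m (leq^~ M) (relabel f A).
  by rewrite /bounded gens_relabel size_map all_map.
have bR' A : bounded m (leq^~ M) (relabel f A) -> bounded m (fun n => f n <= M) A.
  by rewrite /bounded gens_relabel size_map all_map.
rewrite -eAs -eC; subst W'.
pose Q As C := derives (nts [:: relabel f C]) (nts (map (relabel f) As)).
apply: (@thin_binary m (fun n => f n <= M) Q) => //.
- move=> Bs B sB dB /andP[bB bBs]; apply: derives_sequent; first by rewrite size_map.
    by have := der_relabel f dB; rewrite -!map_comp.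
  by rewrite /= bR //= all_map; apply: sub_all bBs => A; apply: bR.
- move=> U K V E B; rewrite /Q /nts !map_cat /= => dK dB.
  exact: (@derives_replace _ G _ _ (nts [:: relabel f E]) _ _ dB dK).
- move: b; rewrite -eC -eAs /= all_map => /andP[/bR' -> b].
  by apply: sub_all b => A; apply: bR'.
Qed.

Definition word_types (W : word) : seq itp := pmap (fun s => if s is Ty A then Some A else None) W.

Lemma derives_unary A B : A \in N -> B \in N ->
  (forall w, lang lex B w -> lang lex A w) -> derives (nts [:: A]) (nts [:: B]).
Proof.
move=> nA nB h; apply: derives_rule; apply/RP; split=> // w /= [u [v [-> + ->]]].
by rewrite !ntK // cats0; apply: h.
Qed.

Lemma derives_flat_word W As C : W = map Ty As -> der W C -> all (ty_in P) W -> P C ->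
  derives (nts [:: C]) (nts (word_types W)).
Proof.
move=> -> d aW pC; rewrite [word_types _](_ : _ = As); last by elim: (As) => //= A As' ->.
apply: derives_flat d _; rewrite /= bP //.
by move: aW; rewrite all_map; apply: sub_all => A; apply: bP.
Qed.

Definition is_op (s : sym) : bool := if s is Op _ then true else false.

(** Each use of [bracket_splitP] removes a pair of brackets.  The two halves of the
    split are joined by a unary rule from the modal type to its argument or vice
    versa, which is sound because brackets do not show in the yield. *)
Lemma derives_word W C : der W C -> all (ty_in P) W -> P C ->
  derives (nts [:: C]) (nts (word_types W)).
Proof.
move: {2}(count is_op W) (leqnn (count is_op W)) => n.
elim: n W C => [|n IH] W C nW d aW pC;
  have [[As eW]|[U [i [X [V [eW bX]]]]]] := flat_or_bracket (der_bal d);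
  try by apply: derives_flat_word eW d aW pC.
  by move: nW; rewrite eW count_cat /=; lia.
subst W; have [F sF] := bracket_splitP cP bX d aW pC.
have eT : word_types (U ++ Op i :: X ++ Cl :: V) = word_types U ++ word_types X ++ word_types V.
  by rewrite /word_types pmap_cat /= pmap_cat.
move: nW aW; rewrite eT !count_cat /= count_cat /= all_cat /= all_cat /= => nW /and3P[aU aX aV].
have PF : P F by case: sF => -[pF _ _]; exact: cP pF.
have glue A B : P A -> der X B -> P B -> derives (nts [:: A]) (nts [:: B]) ->
    der (U ++ Ty A :: V) C -> derives (nts [:: C]) (nts (word_types U ++ word_types X ++ word_types V)).
  move=> pA dX pB dAB dC; rewrite /nts !map_cat.
  apply: (@derives_replace _ G _ _ (nts [:: A])); last first.
    by apply: derives_trans dAB _; apply: IH => //; lia.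
  have := IH _ _ _ dC _ pC; rewrite /word_types pmap_cat /= /nts map_cat; apply.
    by rewrite count_cat /=; lia.
  by rewrite all_cat /= aU pA.
case: sF => -[pF d1 d2].
- apply: (glue _ _ pF d1 PF _ d2); apply: derives_unary (P_N pF) (P_N PF) _ => w.
  exact: lang_dia.
- apply: (glue _ _ PF d1 pF _ d2); apply: derives_unary (P_N PF) (P_N pF) _ => w.
  exact: lang_box.
Qed.

Lemma derives_letters As w : all (fun A => P (emb A)) As ->
  all2 (fun a A => (a, A) \in lex) w As -> derives (nts (map emb As)) (map inr w).
Proof.
elim: As w => [|A As IH] [|a w] //= => [_ _|/andP[/P_N nA pAs] /andP[aA h]]; first exact: rt_refl.
have d1 : derives (nts [:: emb A]) [:: inr a].
  apply: derives_rule; apply/RP; split=> // w' /= [u [v [-> -> ->]]]; rewrite ntK //.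
  by apply: lang_lex; rewrite embK.
have := derives_context [::] (nts (map emb As)) d1; rewrite !cat0s => d2.
apply: derives_trans d2 _.
by have := derives_context [:: inr a] [::] (IH _ pAs h); rewrite !cats0.
Qed.

Lemma cfg_language_lang w : P D -> cfg_language G w -> lang lex D w.
Proof.
move=> pD d.
have h (s t : seq (nonterminal G + Sigma)) :
    derives s t -> @matches Sigma lex N t w -> @matches Sigma lex N s w.
  elim=> {s t d} [_ _ [u v X alpha r]|//|s t s' _ IH _ IH' /IH'/IH //].
  move=> /matches_cat[w1 [w2 [-> m1 /matches_cat[w3 [w4 [-> m3 m4]]]]]].
  apply/matches_cat; exists w1, (w3 ++ w4); split=> //.
  exists w3, w4; split=> //; exact: ((RP _).1 r).2.
have := h _ _ d (matches_letters lex N w); case=> u [v [-> + ->]].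
by rewrite cats0 ntK // P_N.
Qed.

Lemma word_types_cat U V : word_types (U ++ V) = word_types U ++ word_types V.
Proof. exact: pmap_cat. Qed.

Lemma word_types_hedge H : word_types (hedge_word H) = map emb (yield H).
Proof.
elim/hedge_ind: H => // [A H IH|K H IK IH].
  by rewrite hedge_word_cons word_types_cat IH.
rewrite hedge_word_cons word_types_cat IH /yield /= map_cat -/(yield K) -IK; congr (_ ++ _).
by rewrite -[LHS]/(word_types (hedge_word K ++ [:: Cl])) word_types_cat cats0.
Qed.

Lemma lang_cfg_language A0 w : D = emb A0 -> P D ->
  (forall a A, (a, A) \in lex -> P (emb A)) -> lang lex D w -> cfg_language G w.
Proof.
move=> eD pD pL [H pH aH].
have pY : all (fun A => P (emb A)) (yield H).
  elim: (yield H) (w) aH => [|A Y IH] [|a w'] //= /andP[/pL -> /IH]; exact.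
apply: derives_trans (derives_letters pY aH).
rewrite -word_types_hedge; apply: (@derives_word _ D) => //.
  by have := provable_der pH; rewrite eD embK.
elim/hedge_ind: H pY {pH aH} => // [A H IH /andP[pA /IH]|K H IK IH].
  by rewrite hedge_word_cons /= pA.
rewrite -[yield _]/(yield K ++ yield H) all_cat => /andP[/IK aK /IH aH].
by rewrite hedge_word_cons /= -/(hedge_word K) all_cat all_cat /= aK.
Qed.
End Completeness.

Theorem theorem8 (Sigma : finType) (G : ld_grammar Sigma) :
  context_free (ld_language G).
Proof.
pose D := emb (target G).
pose S := flatten (map subtypes (D :: map (fun x => emb x.2) (lexicon G))).
pose m := \max_(A <- S) size (gens A).
pose M := \max_(A <- S) \max_(n <- gens A) n.
have bS A : A \in S -> bounded m (leq^~ M) A.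
  move=> AS; apply/andP; split; first exact: leq_bigmax_seq.
  by apply/allP => n nA; apply: (bigmaxn_sup_seq A) => //; apply: (bigmaxn_sup_seq n).
have SS A : A \in D :: map (fun x => emb x.2) (lexicon G) -> A \in S.
  by move=> h; apply/flatten_mapP; exists A => //; apply: subtypes_refl.
have SD : D \in S by apply: SS; rewrite inE eqxx.
have [R RP] := cfg_of_sound_rules (lexicon G) (types_upto M m).
exists (CFG (nt (types_upto M m) D) R) => w; split=> h.
- have cS := @subtypes_closed (D :: map (fun x => emb x.2) (lexicon G)).
  apply: (lang_cfg_language cS bS RP (erefl D) SD) => [a A aA|].
    by apply: SS; rewrite inE; apply/orP; right; apply/mapP; exists (a, A).
  by case: h => H pH aH; exists H => //; rewrite embK.
- have [H pH aH] := cfg_language_lang bS RP SD h; exists H => //.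
  by rewrite embK in pH.
Qed.
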